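(* Let $G$ be a locally compact, second countable group, and let $\mu$ denote the Haar measure on $G$. Then there exists a proper affine isometric action $\alpha$ of $G$ on the separable, strictly convex, reflexive Banach space $$X=\bigoplus_{n=1}^\infty L^{2n}(G,\mu)\quad\text{(in the } \ell^2 \text{ sense)}.$$
   Context: Topological groups are assumed Hausdorff. $\mu$ is a left Haar measure on $G$, and the $L^{2n}(G,\mu)$ are the spaces of real-valued functions. The direct sum in the $\ell^2$ sense consists of sequences $\xi=(\xi_n)_{n\ge1}$ with $\xi_n\in L^{2n}(G,\mu)$ and $\|\xi\|_X=\left(\sum_{n=1}^\infty\|\xi_n\|_{2n}^2\right)^{1/2}<\infty$. A normed space $X$ is strictly convex if $\|\tfrac12(x+y)\|<1$ for all $x\ne y$ with $\|x\|=\|y\|=1$. For a normed vector space $X$, $\operatorname{Aff}(X)=\{\phi:X\to X : \phi(x)=Ax+b,\ A\in GL(X),\ b\in X\}$. An affine action of $G$ on $X$ is a group homomorphism $\alpha:G\to\operatorname{Aff}(X)$, i.e. $\alpha(gh)=\alpha(g)\circ\alpha(h)$ for all $g,h\in G$; write $\alpha(g)\xi=\pi_g\xi+b(g)$ with linear part $\pi_g$ and translation part $b(g)$. The action is isometric if $\|\pi_g\xi\|=\|\xi\|$ for all $g\in G$, $\xi\in X$. The action is proper if for every $\xi\in X$, $\lim_{g\to\infty}\|\alpha(g)\xi\|=\infty$, where $g\to\infty$ means that $g$ eventually leaves every compact subset of $G$ (that is, for every $\xi\in X$ and $C>0$ there is a compact $K\subset G$ with $\|\alpha(g)\xi\|\ge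 C$ for all $g\in G\setminus K$). *)

(* Defs.v *)
From HB Require Import structures.
From mathcomp Require Import all_boot all_order all_algebra.
From mathcomp Require Import all_classical all_reals all_analysis.
From mathcomp Require Import measurable_realfun ess_sup_inf.

Set Implicit Arguments.
Unset Strict Implicit.
Unset Printing Implicit Defensive.

Import Order.TTheory GRing.Theory Num.Theory.
Import numFieldNormedType.Exports.

Local Open Scope classical_set_scope.
Local Open Scope ring_scope.

(* The library defines L^p as the type [LspaceType] of almost everywhere classes
   but does not provide its structure of normed space. *)
Section Lspace_fun.
Context d (T : measurableType d) (R : realType).
Variables (mu : {measure set T -> \bar R}) (p : \bar R) (p1 : (1 <= p)%E).

Local Notation Q := (@aeEqMfun _ _ R T (measurableTypeR R) mu).

Lemma ae_eq_Lnorm (f g : T -> R) :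
  measurable_fun [set: T] f -> measurable_fun [set: T] g ->
  f = g %[ae mu] -> ('N[mu]_p[EFin \o f] = 'N[mu]_p[EFin \o g])%E.
Proof using p1.
move=> mf mg fg; rewrite unlock /Lnorm; case: p p1 => [r r1|_|//].
- congr (_ `^ _)%E; apply: ge0_ae_eq_integral => //=.
  + apply/measurable_EFinP; apply: (@measurableT_comp _ _ _ _ _ _ (@powR R ^~ r)).
      exact: measurable_powR.
    exact: measurableT_comp.
  + apply/measurable_EFinP; apply: (@measurableT_comp _ _ _ _ _ _ (@powR R ^~ r)).
      exact: measurable_powR.
    exact: measurableT_comp.
  + by apply: filterS fg => x /(_ I) fgx _; rewrite fgx.
- case: ifPn => // _; apply: eq_ess_sup.
  by apply: filterS fg => x /(_ I) /= ->.
Qed.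

Lemma repr_Lfun (f : LspaceType mu p1) : (repr (f : Q) : T -> R) \in Lfun mu p.
Proof.
apply/andP; split; rewrite inE /=.
  exact: (@measurable_funPT _ _ T (measurableTypeR R) (repr (f : Q))).
exact: (@Lebesgue_finite _ _ _ _ _ _ f).
Qed.

Definition Lspace_repr (f : LspaceType mu p1) : LfunType mu p1 :=
  Lfun_Sub p1 (repr_Lfun f).

(* The structures of measurable type on [R] and [measurableTypeR R] have the
   same measurable sets but not the same display. *)
Definition Lfun_mfun (f : LfunType mu p1) : {mfun T >-> measurableTypeR R} :=
  @MeasurableFun.Pack _ _ T (measurableTypeR R) f
    (MeasurableFun.Class
      (@isMeasurableFun.Build _ _ T (measurableTypeR R) f
        (@measurable_funPT _ _ T R f))).

Lemma repr_piE (f : LfunType mu p1) :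
  (repr (\pi_Q (Lfun_mfun f))%qT : T -> R) = f %[ae mu].
Proof.
have /eqP := @reprK _ Q (\pi_Q (Lfun_mfun f))%qT.
by rewrite eqmodE => /asboolP.
Qed.

Lemma pi_finite (f : LfunType mu p1) :
  finite_norm mu p (repr (\pi_Q (Lfun_mfun f))%qT : T -> R).
Proof.
rewrite /finite_norm (ae_eq_Lnorm _ _ (repr_piE f)).
- exact: Lfunction_finite.
- exact: (@measurable_funPT _ _ T (measurableTypeR R)).
- exact: measurable_funPT.
Qed.

Definition Lspace_pi (f : LfunType mu p1) : LspaceType mu p1 :=
  @LebesgueSpace.Pack _ _ _ _ _ _ (\pi_Q (Lfun_mfun f))%qT
    (LebesgueSpace.Class (@isFinLebesgue.Build _ _ _ _ _ p1 _ (pi_finite f))).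

Lemma Lspace_piK (f : LfunType mu p1) :
  (Lspace_repr (Lspace_pi f) : T -> R) = f %[ae mu].
Proof. exact: repr_piE. Qed.

Lemma Lspace_eqP (f g : LspaceType mu p1) :
  (Lspace_repr f : T -> R) = Lspace_repr g %[ae mu] -> f = g.
Proof.
move=> fg; have : (f : Q) = g :> Q.
  rewrite -(reprK (f : Q)) -(reprK (g : Q)).
  by apply/eqP; rewrite eqmodE; apply/asboolP.
case: f g {fg} => [f [[Pf]]] [g [[Pg]]] /= fg; subst g.
by rewrite (Prop_irrelevance Pf Pg).
Qed.

(* The operations of L^p act on classes through the chosen representatives,
   which are only determined almost everywhere. *)
Definition Lspace_norm (f : LspaceType mu p1) : R :=
  fine ('N[mu]_p[EFin \o Lspace_repr f])%E.

Lemma Lspace_norm_pi (f : LfunType mu p1) :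
  Lspace_norm (Lspace_pi f) = fine ('N[mu]_p[EFin \o f])%E.
Proof.
congr fine; apply: ae_eq_Lnorm; try exact: measurable_funPT.
exact: Lspace_piK.
Qed.

Definition Lspace_zero := Lspace_pi 0.
Definition Lspace_add f g := Lspace_pi (Lspace_repr f + Lspace_repr g).
Definition Lspace_opp f := Lspace_pi (- Lspace_repr f).
Definition Lspace_scale (a : R) f := Lspace_pi (a *: Lspace_repr f).

Let zeroE : (Lspace_repr Lspace_zero : T -> R) = (fun=> 0) %[ae mu].
Proof. exact: Lspace_piK. Qed.
Let addE f g : (Lspace_repr (Lspace_add f g) : T -> R) =
  (fun x => Lspace_repr f x + Lspace_repr g x) %[ae mu].
Proof. exact: Lspace_piK. Qed.
Let oppE f : (Lspace_repr (Lspace_opp f) : T -> R) =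
  (fun x => - Lspace_repr f x) %[ae mu].
Proof. exact: Lspace_piK. Qed.
Let scaleE a f : (Lspace_repr (Lspace_scale a f) : T -> R) =
  (fun x => a * Lspace_repr f x) %[ae mu].
Proof. exact: Lspace_piK. Qed.

Let addA : associative Lspace_add.
Proof.
move=> f g h; apply: Lspace_eqP.
have e1 := addE f (Lspace_add g h); have e2 := addE g h.
have e3 := addE (Lspace_add f g) h; have e4 := addE f g.
by near=> x => _; rewrite (near e1)// (near e2)// (near e3)// (near e4)// addrA.
Unshelve. all: by end_near. Qed.

Let addC : commutative Lspace_add.
Proof. by move=> f g; rewrite /Lspace_add addrC. Qed.

Let add0 : left_id Lspace_zero Lspace_add.
Proof.
move=> f; apply: Lspace_eqP.
have e1 := addE Lspace_zero f; have e2 := zeroE.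
by near=> x => _; rewrite (near e1)// (near e2)// add0r.
Unshelve. all: by end_near. Qed.

Let addN : left_inverse Lspace_zero Lspace_opp Lspace_add.
Proof.
move=> f; apply: Lspace_eqP.
have e1 := addE (Lspace_opp f) f; have e2 := zeroE; have e3 := oppE f.
by near=> x => _; rewrite (near e1)// (near e2)// (near e3)// addNr.
Unshelve. all: by end_near. Qed.

HB.instance Definition _ := gen_eqMixin (LspaceType mu p1).
HB.instance Definition _ := gen_choiceMixin (LspaceType mu p1).
HB.instance Definition _ :=
  GRing.isZmodule.Build (LspaceType mu p1) addA addC add0 addN.

Let scaleA a b f :
  Lspace_scale a (Lspace_scale b f) = Lspace_scale (a * b) f.
Proof.
apply: Lspace_eqP.
have e1 := scaleE a (Lspace_scale b f); have e2 := scaleE b f.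
have e3 := scaleE (a * b) f.
by near=> x => _; rewrite (near e1)// (near e2)// (near e3)// mulrA.
Unshelve. all: by end_near. Qed.

Let scale1 : left_id 1 Lspace_scale.
Proof.
move=> f; apply: Lspace_eqP; have e1 := scaleE 1 f.
by near=> x => _; rewrite (near e1)// mul1r.
Unshelve. all: by end_near. Qed.

Let scaleDr : right_distributive Lspace_scale +%R.
Proof.
move=> a f g; apply: Lspace_eqP.
have e1 := scaleE a (f + g); have e2 := addE f g.
have e3 := addE (Lspace_scale a f) (Lspace_scale a g).
have e4 := scaleE a f; have e5 := scaleE a g.
near=> x => _; rewrite (near e1)// (near e2)// (near e3)//.
by rewrite (near e4)// (near e5)// mulrDr.
Unshelve. all: by end_near. Qed.

Let scaleDl f : {morph Lspace_scale^~ f : a b / a + b}.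
Proof.
move=> a b; apply: Lspace_eqP.
have e1 := scaleE (a + b) f.
have e3 := addE (Lspace_scale a f) (Lspace_scale b f).
have e4 := scaleE a f; have e5 := scaleE b f.
near=> x => _; rewrite (near e1)// (near e3)//.
by rewrite (near e4)// (near e5)// mulrDl.
Unshelve. all: by end_near. Qed.

HB.instance Definition _ := GRing.Zmodule_isLmodule.Build R (LspaceType mu p1)
  scaleA scale1 scaleDr scaleDl.

Let normD (f g : LspaceType mu p1) :
  Lspace_norm (f + g) <= Lspace_norm f + Lspace_norm g.
Proof. by rewrite [X in X <= _]Lspace_norm_pi; exact: ler_LnormD. Qed.

Let normZ (a : R) (f : LspaceType mu p1) :
  Lspace_norm (a *: f) = `|a| * Lspace_norm f.
Proof.
rewrite [LHS]Lspace_norm_pi; apply: EFin_inj.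
by rewrite EFinM !finite_norm_fine LnormZ.
Qed.

Let norm_eq0 (f : LspaceType mu p1) : Lspace_norm f = 0 -> f = 0.
Proof.
move=> /fine_Lnormr_eq0 f0; apply: Lspace_eqP.
have e1 := zeroE.
by near=> x => _; rewrite (near f0)// (near e1).
Unshelve. all: by end_near. Qed.

HB.instance Definition _ :=
  Lmodule_isNormed.Build R (LspaceType mu p1) normD normZ norm_eq0.

End Lspace_fun.

(* l^2 direct sum of a sequence of normed spaces. *)
Section l2sum.
Context (R : realType) (V : nat -> normedModType R).

Record l2sum : Type := L2sum {
  l2sum_fun :> forall n, V n ;
  l2sum_finite : (\sum_(0 <= n <oo) (`|l2sum_fun n| ^+ 2)%:E < +oo)%E }.

Definition l2sum_norm (x : l2sum) : R :=
  Num.sqrt (fine (\sum_(0 <= n <oo) (`|x n| ^+ 2)%:E)%E).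

Let N (x : forall n, V n) : \bar R := Lnorm counting 2%:E (fun n => `|x n|%:E).

Let NE x : N x = ((\sum_(0 <= n <oo) (`|x n| ^+ 2)%:E) `^ 2^-1)%E.
Proof.
rewrite /N Lnorm_counting//; congr (_ `^ _)%E; apply: eq_eseriesr => n _.
by rewrite abse_EFin normr_id poweR_EFin powR_mulrn.
Qed.

Let sum_ge0 (x : forall n, V n) : (0 <= \sum_(0 <= n <oo) (`|x n| ^+ 2)%:E)%E.
Proof. by apply: nneseries_ge0 => n _ _; rewrite lee_fin sqr_ge0. Qed.

Let N_lty x :
  (N x < +oo)%E <-> (\sum_(0 <= n <oo) (`|x n| ^+ 2)%:E < +oo)%E.
Proof.
rewrite NE; split; last by move=> ?; rewrite poweR_lty.
by apply: lty_poweRy; rewrite invr_neq0.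
Qed.

Let N_norm (x : l2sum) : N x = (l2sum_norm x)%:E.
Proof.
rewrite NE /l2sum_norm; have := l2sum_finite x; have := sum_ge0 x.
case: (X in (X `^ _)%E) => //= r r0 _.
by rewrite -powR12_sqrt.
Qed.

Let ND (x y : forall n, V n) : (N (fun n => (x n + y n)%R) <= N x + N y)%E.
Proof.
pose nx n := `|x n|; pose ny n := `|y n|.
apply: (@le_trans _ _ (Lnorm counting 2%:E (EFin \o (nx \+ ny)))).
  rewrite /N !Lnorm_counting//.
  apply: gt0_ler_poweR; first by rewrite invr_ge0.
  - rewrite in_itv/= leey andbT.
    by apply: nneseries_ge0 => n _ _; rewrite lee_fin powR_ge0.
  - rewrite in_itv/= leey andbT.
    by apply: nneseries_ge0 => n _ _; rewrite lee_fin powR_ge0.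
  - apply: lee_nneseries => [n _ _|n _]; first by rewrite poweR_ge0.
    rewrite lee_fin.
    apply: ge0_ler_powR; rewrite ?nnegrE// normr_id.
    by rewrite (le_trans (ler_normD _ _))// ler_norm.
by apply: eminkowski; [move=> _ Y _|move=> _ Y _|rewrite lee_fin ler1n].
Qed.

Let NZ (a : R) (x : forall n, V n) :
  (\sum_(0 <= n <oo) (`|a *: x n| ^+ 2)%:E =
   (a ^+ 2)%:E * \sum_(0 <= n <oo) (`|x n| ^+ 2)%:E)%E.
Proof.
rewrite -nneseriesZl; last by move=> n _; rewrite lee_fin sqr_ge0.
by apply: eq_eseriesr => n _; rewrite normrZ exprMn real_normK ?num_real// EFinM.
Qed.

Let l2sum_eq (x y : l2sum) : (forall n, x n = y n) -> x = y.
Proof.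
case: x y => [x Px] [y Py] /= xy.
have {xy} e : x = y by apply: functional_extensionality_dep.
by subst y; rewrite (Prop_irrelevance Px Py).
Qed.

Let zero_finite :
  (\sum_(0 <= n <oo) (`|(0 : V n)| ^+ 2)%:E < +oo)%E.
Proof. by rewrite eseries0// => n _ _; rewrite normr0 expr0n. Qed.
Definition l2sum_zero := L2sum zero_finite.

Let add_finite (x y : l2sum) :
  (\sum_(0 <= n <oo) (`|x n + y n| ^+ 2)%:E < +oo)%E.
Proof.
apply/(N_lty (fun n => x n + y n)); apply: le_lt_trans (ND x y) _.
by rewrite lte_add_pinfty//; apply/N_lty; exact: l2sum_finite.
Qed.
Definition l2sum_add x y := L2sum (add_finite x y).

Let scale_finite (a : R) (x : l2sum) :
  (\sum_(0 <= n <oo) (`|a *: x n| ^+ 2)%:E < +oo)%E.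
Proof. by rewrite NZ lte_mul_pinfty ?lee_fin ?sqr_ge0// l2sum_finite. Qed.
Definition l2sum_scale a x := L2sum (scale_finite a x).

Let opp_finite (x : l2sum) :
  (\sum_(0 <= n <oo) (`|- x n| ^+ 2)%:E < +oo)%E.
Proof. by under eq_eseriesr do rewrite normrN; exact: l2sum_finite. Qed.
Definition l2sum_opp x := L2sum (opp_finite x).

Let addA : associative l2sum_add.
Proof. by move=> x y z; apply: l2sum_eq => n /=; rewrite addrA. Qed.
Let addC : commutative l2sum_add.
Proof. by move=> x y; apply: l2sum_eq => n /=; rewrite addrC. Qed.
Let add0 : left_id l2sum_zero l2sum_add.
Proof. by move=> x; apply: l2sum_eq => n /=; rewrite add0r. Qed.
Let addN : left_inverse l2sum_zero l2sum_opp l2sum_add.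
Proof. by move=> x; apply: l2sum_eq => n /=; rewrite addNr. Qed.

HB.instance Definition _ := gen_eqMixin l2sum.
HB.instance Definition _ := gen_choiceMixin l2sum.
HB.instance Definition _ := GRing.isZmodule.Build l2sum addA addC add0 addN.

Let scaleA a b x : l2sum_scale a (l2sum_scale b x) = l2sum_scale (a * b) x.
Proof. by apply: l2sum_eq => n /=; rewrite scalerA. Qed.
Let scale1 : left_id 1 l2sum_scale.
Proof. by move=> x; apply: l2sum_eq => n /=; rewrite scale1r. Qed.
Let scaleDr : right_distributive l2sum_scale +%R.
Proof. by move=> a x y; apply: l2sum_eq => n /=; rewrite scalerDr. Qed.
Let scaleDl x : {morph l2sum_scale^~ x : a b / a + b}.
Proof. by move=> a b; apply: l2sum_eq => n /=; rewrite scalerDl. Qed.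

HB.instance Definition _ := GRing.Zmodule_isLmodule.Build R l2sum
  scaleA scale1 scaleDr scaleDl.

Let normD (x y : l2sum) : l2sum_norm (x + y) <= l2sum_norm x + l2sum_norm y.
Proof. by rewrite -lee_fin EFinD -!N_norm; exact: ND. Qed.

Let normZ (a : R) (x : l2sum) : l2sum_norm (a *: x) = `|a| * l2sum_norm x.
Proof.
rewrite /l2sum_norm [in LHS]NZ fineM//.
  by rewrite sqrtrM ?sqr_ge0// sqrtr_sqr.
by rewrite ge0_fin_numE// l2sum_finite.
Qed.

Let norm_eq0 (x : l2sum) : l2sum_norm x = 0 -> x = 0.
Proof.
rewrite /l2sum_norm => /eqP; rewrite sqrtr_eq0 => s0; apply: l2sum_eq => n /=.
have s1 : (\sum_(0 <= n <oo) (`|x n| ^+ 2)%:E <= 0)%E.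
  by rewrite -[leLHS]fineK ?lee_fin// ge0_fin_numE// l2sum_finite.
apply/eqP; rewrite -normr_eq0 -sqrf_eq0 eq_le sqr_ge0 andbT -lee_fin.
apply: le_trans s1; rewrite (@nneseriesD1 _ _ n)//.
by apply: leeDl; apply: nneseries_ge0 => k _ _; rewrite lee_fin sqr_ge0.
Qed.

HB.instance Definition _ :=
  Lmodule_isNormed.Build R l2sum normD normZ norm_eq0.

End l2sum.

(* Topological dual, with the operator norm. *)
Section dual.
Context (R : realType) (X : normedModType R).

Record dual : Type := Dual {
  dual_fun :> X -> R ;
  dual_scalar : scalar dual_fun ;
  dual_continuous : continuous dual_fun }.

Definition dual_norm (f : dual) : R :=
  sup [set `|f x| | x in [set x | `|x| <= 1]].

Let fZ (f : dual) a x : f (a *: x) = a * f x.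
Proof.
have f0 : f 0 = 0.
  have := dual_scalar f 1 0 0.
  by rewrite scaler0 addr0 mul1r -[LHS]addr0 => /addrI/esym.
by have := dual_scalar f a x 0; rewrite addr0 f0 addr0.
Qed.

Let bounded (f : dual) : exists2 M, 0 <= M & forall x, `|f x| <= M * `|x|.
Proof.
pose g : {linear X -> R^o} :=
  HB.pack (f : X -> R^o) (GRing.isLinear.Build R X R^o *:%R f (dual_scalar f)).
have /linear_bounded_continuous/linear_boundedP/pinfty_ex_gt0[M M0 gM] :
    continuous g by exact: (@dual_continuous f).
by exists M => //; exact: ltW.
Qed.

Let norm_has_sup (f : dual) :
  has_sup [set `|f x| | x in [set x | `|x| <= 1]].
Proof.
have [M M0 fM] := bounded f; split.
  by exists `|f 0|, 0 => //=; rewrite normr0.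
exists M => _ [x /= x1 <-]; apply: le_trans (fM x) _.
by rewrite -[leRHS]mulr1 ler_wpM2l.
Qed.

Let norm_ub (f : dual) x : `|x| <= 1 -> `|f x| <= dual_norm f.
Proof.
move=> x1; apply: sup_upper_bound; first exact: norm_has_sup.
by exists x.
Qed.

Let norm_le (f : dual) M :
  (forall x, `|x| <= 1 -> `|f x| <= M) -> dual_norm f <= M.
Proof.
move=> fM; apply: ge_sup; first by case: (norm_has_sup f).
by move=> _ [x /= x1 <-]; exact: fM.
Qed.

Let dual_eq (f g : dual) : f =1 g -> f = g.
Proof.
case: f g => [f f1 f2] [g g1 g2] /= /funext fg; subst g.
by rewrite (Prop_irrelevance f1 g1) (Prop_irrelevance f2 g2).
Qed.

Let zero_scalar : scalar (fun _ : X => 0 : R).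
Proof. by move=> a x y; rewrite mulr0 addr0. Qed.
Let zero_continuous : continuous (fun _ : X => 0 : R).
Proof. by move=> x; exact: cvg_cst. Qed.
Definition dual_zero := Dual zero_scalar zero_continuous.

Let add_scalar (f g : dual) : scalar (fun x => f x + g x).
Proof. by move=> a x y; rewrite !dual_scalar mulrDr addrACA. Qed.
Let add_continuous (f g : dual) : continuous (fun x => f x + g x).
Proof. by move=> x; apply: (@cvgD R R^o); exact: dual_continuous. Qed.
Definition dual_add f g := Dual (add_scalar f g) (add_continuous (f := f) (g := g)).

Let opp_scalar (f : dual) : scalar (fun x => - f x).
Proof. by move=> a x y; rewrite dual_scalar opprD mulrN. Qed.
Let opp_continuous (f : dual) : continuous (fun x => - f x).
Proof. by move=> x; apply: (@cvgN R R^o); exact: dual_continuous. Qed.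
Definition dual_opp f := Dual (opp_scalar f) (opp_continuous (f := f)).

Let scale_scalar (a : R) (f : dual) : scalar (fun x => a * f x).
Proof. by move=> b x y; rewrite dual_scalar mulrDr mulrCA. Qed.
Let scale_continuous (a : R) (f : dual) : continuous (fun x => a * f x).
Proof. by move=> x; apply: cvgMr; exact: dual_continuous. Qed.
Definition dual_scale a f := Dual (scale_scalar a f) (scale_continuous (a := a) (f := f)).

Let addA : associative dual_add.
Proof. by move=> f g h; apply: dual_eq => x /=; rewrite addrA. Qed.
Let addC : commutative dual_add.
Proof. by move=> f g; apply: dual_eq => x /=; rewrite addrC. Qed.
Let add0 : left_id dual_zero dual_add.
Proof. by move=> f; apply: dual_eq => x /=; rewrite add0r. Qed.
Let addN : left_inverse dual_zero dual_opp dual_add.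
Proof. by move=> f; apply: dual_eq => x /=; rewrite addNr. Qed.

HB.instance Definition _ := gen_eqMixin dual.
HB.instance Definition _ := gen_choiceMixin dual.
HB.instance Definition _ := GRing.isZmodule.Build dual addA addC add0 addN.

Let scaleA a b f : dual_scale a (dual_scale b f) = dual_scale (a * b) f.
Proof. by apply: dual_eq => x /=; rewrite mulrA. Qed.
Let scale1 : left_id 1 dual_scale.
Proof. by move=> f; apply: dual_eq => x /=; rewrite mul1r. Qed.
Let scaleDr : right_distributive dual_scale +%R.
Proof. by move=> a f g; apply: dual_eq => x /=; rewrite mulrDr. Qed.
Let scaleDl f : {morph dual_scale^~ f : a b / a + b}.
Proof. by move=> a b; apply: dual_eq => x /=; rewrite mulrDl. Qed.

HB.instance Definition _ := GRing.Zmodule_isLmodule.Build R dual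
  scaleA scale1 scaleDr scaleDl.

Let normD (f g : dual) : dual_norm (f + g) <= dual_norm f + dual_norm g.
Proof.
apply: norm_le => x x1; apply: le_trans (ler_normD _ _) _.
by apply: lerD; exact: norm_ub.
Qed.

Let normZ_le (a : R) (f : dual) : dual_norm (a *: f) <= `|a| * dual_norm f.
Proof.
apply: norm_le => x x1; rewrite normrM.
by apply: ler_wpM2l => //; exact: norm_ub.
Qed.

Let normZ (a : R) (f : dual) : dual_norm (a *: f) = `|a| * dual_norm f.
Proof.
apply/eqP; rewrite eq_le normZ_le/=.
have [->|a0] := eqVneq a 0.
  by rewrite normr0 mul0r (le_trans _ (norm_ub (x := 0) _ _)) ?normr0.
rewrite -ler_pdivlMl ?normr_gt0// -normfV -[X in dual_norm X <= _]scale1r.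
by rewrite -(mulVf a0) -scalerA; exact: normZ_le.
Qed.

Let norm_eq0 (f : dual) : dual_norm f = 0 -> f = 0.
Proof.
move=> f0; apply: dual_eq => x /=.
have [->|x0] := eqVneq x 0; first by have := fZ f 0 0; rewrite scale0r mul0r.
have : `|f (`|x|^-1 *: x)| <= 0.
  rewrite -f0; apply: norm_ub.
  by rewrite normrZ normfV normr_id mulVf ?normr_eq0.
rewrite normr_le0 fZ mulf_eq0 invr_eq0 normr_eq0 (negbTE x0)/=.
by move/eqP.
Qed.

HB.instance Definition _ :=
  Lmodule_isNormed.Build R dual normD normZ norm_eq0.

End dual.

Section normed_space_properties.
Context (R : realType) (X : normedModType R).

Definition banach_space :=
  forall F : set_system X, ProperFilter F -> cauchy F -> cvg F.

Definition strictly_convex :=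
  forall x y : X, x != y -> `|x| = 1 -> `|y| = 1 -> `|2^-1 *: (x + y)| < 1.

(* Surjectivity of the canonical embedding of X into its bidual. *)
Definition reflexive_space :=
  forall Phi : dual (dual X), exists x : X, forall f : dual X, Phi f = f x.

End normed_space_properties.

Definition separable (T : topologicalType) :=
  exists2 D : set T, countable D & dense D.

HB.mixin Record isTopologicalGroup G & PointedTopological G & Group G := {
  mulg_continuous : continuous (fun x : G * G => (x.1 * x.2)%g) ;
  invg_continuous : continuous (fun x : G => (x^-1)%g)
}.

(* The distinguished point plays no role: it is only there because the
   measurable types of the library are pointed. *)
#[short(type="topologicalGroupType")]
HB.structure Definition TopologicalGroup :=
  {G of PointedTopological G & Group G & isTopologicalGroup G}.

Definition borelType (G : topologicalGroupType) : measurableType _ :=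
  g_sigma_algebraType (@open G).

(* A left Haar measure is a nonzero left-invariant Radon measure. *)
Record left_haar (R : realType) (G : topologicalGroupType)
    (mu : {measure set (borelType G) -> \bar R}) : Prop := {
  left_haar_neq0 : mu [set: G] != 0%E ;
  left_haar_compact : forall K : set G, compact K -> (mu K < +oo)%E ;
  left_haar_outer : forall A : set (borelType G), measurable A ->
    mu A = ereal_inf [set mu U | U in [set U : set G | open U /\ A `<=` U]] ;
  left_haar_inner : forall U : set G, open U ->
    mu U = ereal_sup [set mu K | K in [set K : set G | compact K /\ K `<=` U]] ;
  left_haar_invariant : forall (g : G) (A : set (borelType G)), measurable A ->
    mu [set (g * x)%g | x in (A : set G)] = mu A }.

Lemma le1_even_exponent (R : realType) (n : nat) :
  (1 <= ((2 * n.+1)%:R : R)%:E)%E.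
Proof. by rewrite lee_fin ler1n. Qed.

(* Sequences are indexed from 0: the component of index n lies in L^(2(n+1)). *)
Definition L2n_sum (R : realType) (G : topologicalGroupType)
    (mu : {measure set (borelType G) -> \bar R}) : normedModType R :=
  l2sum (fun n => LspaceType mu (le1_even_exponent R n)).

Definition GL (R : realType) (X : normedModType R) (A : {linear X -> X}) :=
  continuous A /\
  exists B : {linear X -> X}, [/\ continuous B, cancel A B & cancel B A].

Section affine_action.
Context (R : realType) (G : topologicalGroupType) (X : normedModType R).

(* No continuity in g is required. *)
Record affine_action : Type := AffineAction {
  linear_part : G -> {linear X -> X} ;
  translation_part : G -> X ;
  act := fun (g : G) (xi : X) => linear_part g xi + translation_part g ;
  linear_part_GL : forall g, GL (linear_part g) ;
  act_morph : forall g h : G, act (g * h)%g = act g \o act h }.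

Definition isometric_action (alpha : affine_action) :=
  forall (g : G) (xi : X), `|linear_part alpha g xi| = `|xi|.

Definition proper_action (alpha : affine_action) :=
  forall (xi : X) (C : R), 0 < C ->
    exists2 K : set G, compact K & forall g, ~ K g -> C <= `|act alpha g xi|.

End affine_action.

(* Main.v *)
Require Import Defs.
From HB Require Import structures.
From mathcomp Require Import all_boot all_order all_algebra.
From mathcomp Require Import all_classical all_reals all_analysis.
From mathcomp Require Import measurable_realfun.
From mathcomp Require Import ring lra.

Set Implicit Arguments.
Unset Strict Implicit.
Unset Printing Implicit Defensive.

Import Order.TTheory GRing.Theory Num.Theory.
Import numFieldNormedType.Exports.

Local Open Scope classical_set_scope.
Local Open Scope ring_scope.

(** Why the theorem holds.

    The space. For an even exponent p the pointwise inequality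
    ((a+b)/2)^p + ((a-b)/2)^p <= (a^p + b^p)/2 integrates to Clarkson's
    inequality [clarkson], which makes L^p uniformly and strictly convex. L^p is
    complete ([Lspace_banach], by monotone convergence), hence reflexive by the
    Milman-Pettis theorem [milman_pettis]. The latter rests on Goldstine's density
    statement for finitely many functionals at a time, which follows from a
    near-minimisation of a Euclidean distance ([goldstine]). Separability comes from outer regularity of
    the measure and a countable base of the topology
    ([left_haar_countable_approx]) together with the density of simple functions
    ([Lspace_countably_total]). Each of these properties passes to an l^2 sum.
    Uniform convexity would not, because the moduli of convexity of the summands
    degenerate; what passes is the reflexivity of the summands
    ([l2sum_norm_reflexive]): a functional on an l^2 sum has small norm on the
    vectors supported far out, so that it is determined, up to a small error, by
    finitely many components.

    The action. The linear part is left translation on every component, which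
    is isometric because the measure is left invariant. The translation part is
    g |-> (g . phi_n - phi_n)_n, the formal coboundary of a sequence phi with
    phi_n in L^(2(n+1)) that is not square summable: it is automatically a
    cocycle, and one has to choose phi such that the differences are square
    summable for every g, but their norm tends to infinity with g.

    The group is exhausted by compact symmetric sets V_0, V_1, ... with
    V_i V_i contained in V_(i+1). The function psi_k, the average of the
    indicators of V_k, ..., V_(k + 2^k - 1), equals 1 on V_0, vanishes off a
    compact set, and varies by at most 2^-k under translation by an element of
    V_k ([plateau_slow]), because such a translation moves V_i into V_(i+1). Its
    translate by an element outside V_(k + 2^k + 1) vanishes on V_0
    ([plateau_disjoint]). Taking the L^p norm multiplies these uniform bounds by
    the p-th root of the measure of a fixed compact set, and p-th roots tend to
    1. So if psi_k is placed in a component m k whose exponent is large enough,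
    which is possible since all even exponents occur, and phi_n = 0 for the
    other indices n, then the component m k of the cocycle at g has norm at most
    2 * 2^-k as soon as g is in V_k ([coboundary_small]), and at least 1/2 as
    long as g is not in V_(k + 2^k + 1) ([coboundary_large]). The first estimate
    gives square summability, the second one properness. *)

(** * The dual of a normed space *)

Section dual_space.
Context (R : realType) (X : normedModType R).
Implicit Types (f g : dual X) (x y : X).

Lemma dualP f a x y : f (a *: x + y) = a * f x + f y.
Proof. by have := dual_scalar f a x y. Qed.

Lemma dualD f x y : f (x + y) = f x + f y.
Proof. by have := dualP f 1 x y; rewrite scale1r mul1r. Qed.

Lemma dual0 f : f 0 = 0.
Proof. by apply: (@addrI _ (f 0)); rewrite -dualD !addr0. Qed.

Lemma dualZ f a x : f (a *: x) = a * f x.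
Proof. by have := dualP f a x 0; rewrite dual0 !addr0. Qed.

Lemma dualN f x : f (- x) = - f x.
Proof. by rewrite -scaleN1r dualZ mulN1r. Qed.

Lemma dualB f x y : f (x - y) = f x - f y.
Proof. by rewrite dualD dualN. Qed.

Lemma dual_sum f n (u : 'I_n -> X) : f (\sum_i u i) = \sum_i f (u i).
Proof. exact: (big_morph f (dualD f) (dual0 f)). Qed.

Lemma dual_sumE n (f : 'I_n -> dual X) x : (\sum_i f i) x = \sum_i f i x.
Proof. exact: (big_morph (fun g : dual X => g x)). Qed.

Lemma dual_ext f g : f =1 g -> f = g.
Proof.
case: f g => [f f1 f2] [g g1 g2] /= /funext fg; subst g.
by rewrite (Prop_irrelevance f1 g1) (Prop_irrelevance f2 g2).
Qed.

Lemma ler_dual f x : `|f x| <= `|f| * `|x|.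
Proof.
pose A := [set `|f x| | x in [set x | `|x| <= 1]].
have [M M0 fM] : exists2 M, 0 <= M & forall x, `|f x| <= M * `|x|.
  pose g : {linear X -> R^o} :=
    HB.pack (f : X -> R^o) (GRing.isLinear.Build R X R^o *:%R f (dual_scalar f)).
  have /linear_bounded_continuous/linear_boundedP/pinfty_ex_gt0[M M0 gM] :
      continuous g by exact: (@dual_continuous _ _ f).
  by exists M => //; exact: ltW.
have ubA : has_ubound A.
  exists M => _ [z /= z1 <-]; apply: le_trans (fM z) _.
  by rewrite -[leRHS]mulr1 ler_wpM2l.
have [->|x0] := eqVneq x 0; first by rewrite dual0 !normr0 mulr0.
have : `|f (`|x|^-1 *: x)| <= `|f|.
  apply: ub_le_sup => //; exists (`|x|^-1 *: x) => //=.
  by rewrite normrZ normfV normr_id mulVf ?normr_eq0.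
rewrite dualZ normrM normfV normr_id ler_pdivrMl ?normr_gt0//.
by rewrite mulrC.
Qed.

Lemma dual_norm_le f M : (forall x, `|x| <= 1 -> f x <= M) -> `|f| <= M.
Proof.
move=> fM; apply: ge_sup; first by exists `|f 0|, 0 => //=; rewrite normr0.
move=> _ [x /= x1 <-]; rewrite ler_norml fM// andbT lerNl -dualN fM//.
by rewrite normrN.
Qed.

(** The norm bound supplies the continuity that an element of the dual carries. *)
Lemma bounded_dual (h : X -> R) M : scalar h -> 0 <= M ->
    (forall x, `|h x| <= M * `|x|) ->
  exists2 f : dual X, f =1 h & `|f| <= M.
Proof.
move=> hs M0 hM.
have hc : continuous h.
  pose g : {linear X -> R^o} :=
    HB.pack (h : X -> R^o) (GRing.isLinear.Build R X R^o *:%R h hs).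
  have : continuous g.
    apply/linear_bounded_continuous/linear_boundedP.
    near=> r => x; apply: le_trans (hM x) _.
    by apply: ler_wpM2r => //; near: r; exact: nbhs_pinfty_ge.
  by [].
exists (Dual hs hc) => //; apply: dual_norm_le => x x1.
apply: le_trans (ler_norm _) _; apply: le_trans (hM x) _.
by rewrite -[leRHS]mulr1 ler_wpM2l.
Unshelve. all: by end_near. Qed.

End dual_space.

(** * Reflexivity of uniformly convex Banach spaces *)

Section goldstine.
Context (R : realType) (X : normedModType R).

(** Goldstine's theorem for finitely many functionals. The points (f_i x)_i with
    |x| <= 1 form a convex subset of a Euclidean space. If it stayed away from the
    point (Phi f_i)_i, a nearly closest point x would give a hyperplane that almost
    separates, that is a combination g of the f_i with g <= Phi g - d / 2 on the
    unit ball, against |Phi| <= 1. *)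
Lemma goldstine (Phi : dual (dual X)) n (f : 'I_n -> dual X) (e : R) :
  `|Phi| <= 1 -> 0 < e ->
  exists2 x, `|x| <= 1 & forall i, `|Phi (f i) - f i x| <= e.
Proof.
move=> Phi1 e0.
pose c x i := Phi (f i) - f i x.
pose D x := \sum_i c x i ^+ 2.
have D0 x : 0 <= D x by apply: sumr_ge0 => i _; exact: sqr_ge0.
pose A := [set D x | x in [set x | `|x| <= 1]].
have A0 : A !=set0 by exists (D 0), 0 => //=; rewrite normr0.
have hlA : has_lbound A by exists 0 => _ [x _ <-].
have infA : has_inf A by split.
pose d := inf A.
have dD x : `|x| <= 1 -> d <= D x by move=> x1; apply: ge_inf => //; exists x.
have [de|ed] := ltP d (e ^+ 2).
  have /inf_lt[//|_ [x /= x1 <-] xe] := de; exists x => // i.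
  rewrite -(ler_pXn2r (n:=2))// ?nnegrE ?(ltW e0)// real_normK ?num_real//.
  apply: le_trans (ltW xe); rewrite /D (bigD1 i)//= lerDl.
  by apply: sumr_ge0 => j _; exact: sqr_ge0.
have {ed} d0 : 0 < d by apply: lt_le_trans ed; rewrite exprn_gt0.
pose M := \sum_i (2 * `|f i|) ^+ 2.
have M0 : 0 <= M by apply: sumr_ge0 => i _; exact: sqr_ge0.
(* Moving from x towards y by t changes D by -2 t <c, f y - f x> + O(t^2), with
   M bounding the second order term; a defect t^2 in the minimality of x thus
   costs t (1 + M) / 2 <= d / 2 in the separation. *)
pose t := Num.min 1 (d / (1 + M)).
have t0 : 0 < t by rewrite lt_min ltr01/= divr_gt0// ltr_pwDl.
have t1 : t <= 1 by rewrite ge_min lexx.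
have td : t * (1 + M) <= d.
  by rewrite -ler_pdivlMr ?ltr_pwDl// ge_min lexx orbT.
have [|_ [x /= x1 <-] xt] := @inf_adherent _ A (t ^+ 2) _ infA.
  by rewrite exprn_gt0.
pose g : dual X := \sum_i c x i *: f i.
have gE y : g y = \sum_i c x i * f i y by rewrite dual_sumE.
have PhigE : Phi g = \sum_i c x i * Phi (f i).
  by rewrite dual_sum; apply: eq_bigr => i _; rewrite dualZ.
have key : Phi g - g x = D x.
  rewrite gE PhigE -sumrB; apply: eq_bigr => i _.
  by rewrite -mulrBr expr2.
have gy y : `|y| <= 1 -> g y <= Phi g - d / 2.
  move=> y1.
  have z1 : `|x + t *: (y - x)| <= 1.
    have -> : x + t *: (y - x) = (1 - t) *: x + t *: y.
      by rewrite scalerBr scalerBl scale1r addrA addrAC.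
    apply: le_trans (ler_normD _ _) _; rewrite !normrZ.
    rewrite ger0_norm ?subr_ge0// (ger0_norm (ltW t0)).
    nra.
  have := dD _ z1.
  have -> : D (x + t *: (y - x)) =
      D x - 2 * t * (g y - g x) + t ^+ 2 * \sum_i (f i y - f i x) ^+ 2.
    rewrite !gE -sumrB mulr_sumr -sumrB mulr_sumr -big_split/=.
    apply: eq_bigr => i _; rewrite /c dualD dualZ dualB; ring.
  have : \sum_i (f i y - f i x) ^+ 2 <= M.
    apply: ler_sum => i _; rewrite -real_normK ?num_real// lerXn2r ?nnegrE//.
    rewrite -dualB; apply: le_trans (ler_dual _ _) _; rewrite mulrC ler_wpM2r//.
    by apply: le_trans (ler_normB _ _) _; rewrite -[2]/(1+1) lerD.
  move: xt; rewrite -/d => xt.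
  move: (\sum_i _) => S SM dS.
  have : 2 * t * (g y - g x) <= t ^+ 2 * (1 + M) by nra.
  rewrite expr2 -mulrA [2 * _]mulrCA -mulrA ler_pM2l// => h.
  have : d <= D x by exact: dD.
  rewrite -key; lra.
have := dual_norm_le gy.
have := ler_dual Phi g.
have : `|Phi| * `|g| <= `|g| by rewrite ler_piMl.
have := ler_norm (Phi g).
lra.
Qed.
End goldstine.

Lemma near_norming (R : realType) (X : normedModType R) (f : dual X) (e : R) :
  0 < e -> exists2 x, `|x| <= 1 & `|f| - e < f x.
Proof.
move=> e0; apply: contrapT => /forall2NP H.
suff : `|f| <= `|f| - e by rewrite leNgt ltrBlDr ltrDl e0.
apply: dual_norm_le => x x1; have [//|/negP] := H x.
by rewrite -leNgt.
Qed.

Section milman_pettis.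
Context (R : realType) (X : normedModType R).

Definition uniformly_convex := forall e : R, 0 < e ->
  exists2 d : R, 0 < d & forall x y : X, `|x| <= 1 -> `|y| <= 1 ->
    1 - d <= `|2^-1 *: (x + y)| -> `|x - y| < e.

(** Reflexivity with control of the norm: the bound makes a representing vector
    approximately normed by functionals, as the treatment of l^2 sums requires. *)
Definition norm_reflexive := forall Phi : dual (dual X),
  exists2 x : X, (forall f : dual X, Phi f = f x) & `|x| <= `|Phi|.

Lemma norm_reflexive_unit :
  (forall Phi : dual (dual X), `|Phi| = 1 ->
    exists2 x : X, (forall f : dual X, Phi f = f x) & `|x| <= 1) ->
  norm_reflexive.
Proof.
move=> H Phi; have [->|Phi0] := eqVneq Phi 0.
  by exists 0; [move=> f; rewrite dual0|rewrite normr0].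
have nPhi0 : `|Phi| != 0 by rewrite normr_eq0.
have [|x xE x1] := H (`|Phi|^-1 *: Phi).
  by rewrite normrZ normfV normr_id mulVf.
exists (`|Phi| *: x) => [f|].
  rewrite dualZ -xE -[in RHS]/(`|Phi| * (`|Phi|^-1 * Phi f)).
  by rewrite mulrA divff// mul1r.
by rewrite normrZ normr_id -[leRHS]mulr1 ler_wpM2l.
Qed.

(** By Goldstine's theorem the sets of unit ball vectors on which finitely many
    functionals nearly agree with Phi form a filter base. This filter is Cauchy:
    if f nearly norms Phi, any two vectors x, y on which f is close to Phi f have a
    midpoint of norm close to 1, so uniform convexity brings x and y together. Its
    limit represents Phi. *)
Lemma milman_pettis : banach_space X -> uniformly_convex -> norm_reflexive.
Proof.
move=> Xb Xuc; apply: norm_reflexive_unit => Phi Phi1.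
pose B (i : seq (dual X) * R) := [set x : X | `|x| <= 1 /\
  forall f, f \in i.1 -> `|Phi f - f x| <= i.2].
pose F := filter_from [set i : seq (dual X) * R | 0 < i.2] B.
have B0 i : 0 < i.2 -> B i !=set0.
  move=> i0; have Phi1' : `|Phi| <= 1 by rewrite Phi1.
  have [x x1 xf] := goldstine (tnth (in_tuple i.1)) Phi1' i0.
  by exists x; split=> // f /seq_tnthP[k ->]; exact: xf.
have FF : ProperFilter F.
  apply: filter_from_proper => //; apply: filter_from_filter.
    by exists ([::], 1) => /=.
  move=> [s e] [s' e'] /= e0 e0'.
  exists (s ++ s', Num.min e e') => /=; first by rewrite lt_min e0.
  move=> x [x1 xf]; split; split=> // f fs; apply: le_trans (xf f _) _ => /=.
  - by rewrite mem_cat fs.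
  - by rewrite ge_min lexx.
  - by rewrite mem_cat fs orbT.
  - by rewrite ge_min lexx orbT.
have FB i : 0 < i.2 -> F (B i) by exists i.
have Fc : cauchy F.
  apply: cauchy_exP => e e0.
  have [d d0 dP] := Xuc _ e0.
  have [f f1 fd] : exists2 f : dual X, `|f| <= 1 & 1 - d / 2 < Phi f.
    by rewrite -[X in X - _]Phi1; apply: near_norming; rewrite divr_gt0.
  have i0 : 0 < ([:: f], d / 2).2 by rewrite /= divr_gt0.
  have [x [x1 xf]] := B0 _ i0.
  exists x; exists ([:: f], d / 2) => // y [y1 yf].
  rewrite -ball_normE/=; apply: dP => //.
  apply: le_trans (_ : f (2^-1 *: (x + y)) <= _); last first.
    apply: le_trans (ler_norm _) _; apply: le_trans (ler_dual _ _) _.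
    by rewrite ler_piMl.
  rewrite dualZ dualD.
  have := xf f (mem_head _ _); have := yf f (mem_head _ _) => /=.
  rewrite !ler_norml; lra.
have /cvg_ex[x Fx] := Xb _ FF Fc.
exists x.
  move=> f; apply/eqP; rewrite -subr_eq0 -normr_le0; apply/ler_addgt0Pl => e e0.
  rewrite addr0.
  have e20 : 0 < e / 2 by rewrite divr_gt0.
  have Ff : F (f @^-1` ball (f x) (e / 2)).
    by apply: Fx; apply: (@dual_continuous _ _ f x); exact: nbhsx_ballx.
  have [y [[_ yf] /=]] := filter_ex (filterI (FB ([:: f], e / 2) e20) Ff).
  rewrite -ball_normE/=; have := yf f (mem_head _ _) => /=.
  rewrite !ler_norml ltr_norml; lra.
apply/ler_addgt0Pr => e e0.
have Fe : F (ball x e) by apply: Fx; exact: nbhsx_ballx.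
have [y [[y1 _]]] := filter_ex (filterI (FB ([::], 1) ltr01) Fe).
rewrite -ball_normE/= => xy; rewrite -(subrK y x).
by rewrite (le_trans (ler_normD _ _))// addrC lerD// ltW.
Qed.

Lemma norm_reflexive_reflexive : norm_reflexive -> reflexive_space X.
Proof. by move=> H Phi; have [x xE _] := H Phi; exists x. Qed.

End milman_pettis.

(** * Criteria for completeness and separability *)

Lemma half_expr_cvg (R : realType) : (fun n => 2^-1 ^+ n : R) @ \oo --> (0 : R).
Proof. by apply: cvg_expr; rewrite ger0_norm ?invr_ge0// invf_lt1// ltr1n. Qed.

Section banach_separable.
Context (R : realType) (X : normedModType R).

(** A Cauchy filter contains balls of radius 2^-n / 4; their centres form a fast
    Cauchy sequence, and its limit is a limit of the filter. *)
Lemma banach_criterion :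
  (forall u : nat -> X, (forall n, `|u n.+1 - u n| <= 2^-1 ^+ n) -> cvgn u) ->
  banach_space X.
Proof.
move=> H F FF Fc.
have /choice[u uP] : forall n, exists x, F (ball x (2^-1 ^+ n / 4)).
  by move=> n; apply: (cauchyP F).1 => //; rewrite divr_gt0// exprn_gt0// invr_gt0.
have /H/cvg_ex[l ul] : forall n, `|u n.+1 - u n| <= 2^-1 ^+ n.
  move=> n; have [y []] := filter_ex (filterI (uP n) (uP n.+1)).
  rewrite -!ball_normE/= exprSr [`|_ - y|]distrC => h1 h2.
  have -> : u n.+1 - u n = (u n.+1 - y) + (y - u n) by rewrite addrA subrK.
  apply: le_trans (ler_normD _ _) _.
  have : 0 < 2^-1 ^+ n :> R by rewrite exprn_gt0// invr_gt0.
  move: h1 h2; set q := _ ^+ n; move: q => q h1 h2 q0; lra.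
apply/cvg_ex; exists l => A /nbhs_ballP[e /= e0 eA].
have e20 : 0 < e / 2 by rewrite divr_gt0.
have /cvgrPdist_lt/(_ _ e20) ul' := ul.
have /cvgrPdist_lt/(_ _ e20) q0' := @half_expr_cvg R.
have [n [nl nq]] := @filter_ex _ _ _ _ (filterI ul' q0').
apply: filterS (uP n) => y; rewrite -ball_normE/= => yn; apply: eA.
rewrite -ball_normE/=; rewrite -(subrK (u n) l) -addrA.
apply: le_lt_trans (ler_normD _ _) _.
move: nq => /=; rewrite sub0r normrN ger0_norm ?exprn_ge0 ?invr_ge0//.
have : 0 < 2^-1 ^+ n :> R by rewrite exprn_gt0// invr_gt0.
move: nl yn; rewrite /=; set q := _ ^+ n; move: q => q; lra.
Qed.

(** The rational combinations of S are countable, and their closure is a closed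
    linear subspace that contains S. *)
Lemma separable_total (S : set X) : countable S ->
  (forall M : set X, closed M -> M 0 ->
    (forall a x y, M x -> M y -> M (a *: x + y)) -> S `<=` M ->
    forall x, M x) ->
  separable X.
Proof.
move=> /countable_injP[f finj] H.
pose e n : X := xget 0 [set x | S x /\ f x = n].
have eS x : S x -> exists n, e n = x.
  move=> Sx; exists (f x); rewrite /e; case: xgetP => [y _ [Sy yx]|/(_ x)].
    by apply: finj => //; rewrite inE.
  by case.
pose comb (s : seq (rat * nat)) : X := \sum_(p <- s) ratr p.1 *: e p.2.
have combD s t : comb (s ++ t) = comb s + comb t by rewrite /comb big_cat.
have combZ q s : comb [seq (q * p.1, p.2) | p <- s] = ratr q *: comb s.
  rewrite /comb big_map scaler_sumr; apply: eq_bigr => p _ /=.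
  by rewrite rmorphM scalerA.
pose D := range comb.
exists D; first exact: (card_le_trans (card_image_le _ _) (countableP _)).
have DP x : closure D x <-> forall r : R, 0 < r -> exists s, `|x - comb s| < r.
  split.
    move=> Dx r r0; have [_ [[s _ <-]]] := Dx _ (nbhsx_ballx x r r0).
    by rewrite -ball_normE/=; exists s.
  move=> Dx A /nbhs_ballP[r /= r0 rA]; have [s sr] := Dx r r0.
  by exists (comb s); split; [exists s|apply: rA; rewrite -ball_normE].
suff DT x : closure D x.
  move=> O [x Ox] Oo; have [y [Dy Oy]] := DT x O (open_nbhs_nbhs (conj Oo Ox)).
  by exists y.
apply: H; first exact: closed_closure.
- by apply/DP => r r0; exists [::]; rewrite /comb big_nil subr0 normr0.
- move=> a {}x y /DP Dx /DP Dy; apply/DP => r r0.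
  have x0 : 0 < `|x| + 1 by rewrite ltr_wpDl.
  pose d := r / 3 / (`|x| + 1).
  have d0 : 0 < d by rewrite !divr_gt0.
  have /rat_in_itvoo[q] : a - d < a + d by lra.
  rewrite in_itv/= => /andP[q1 q2].
  have q0 : 0 < `|ratr q : R| + 1 by rewrite ltr_wpDl.
  have [s sx] := Dx (r / 3 / (`|ratr q : R| + 1)) ltac:(by rewrite !divr_gt0).
  have [t ty] := Dy (r / 3) ltac:(by rewrite divr_gt0).
  exists ([seq (q * p.1, p.2) | p <- s] ++ t).
  rewrite combD combZ.
  have -> : a *: x + y - (ratr q *: comb s + comb t) =
      ((a - ratr q) *: x + ratr q *: (x - comb s)) + (y - comb t).
    by rewrite scalerBl scalerBr [X in _ = X + _]addrA subrK opprD addrACA.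
  apply: le_lt_trans (ler_normD _ _) _.
  have h1 : `|(a - ratr q) *: x| <= r / 3.
    rewrite normrZ; have : `|a - ratr q| <= d by rewrite ler_norml; lra.
    rewrite /d ler_pdivlMr// => h; apply: le_trans h.
    by rewrite ler_wpM2l// lerDl.
  have h2 : `|ratr q *: (x - comb s)| <= r / 3.
    rewrite normrZ; move: sx; rewrite ltr_pdivlMr// => /ltW h; apply: le_trans h.
    by rewrite mulrC ler_wpM2l// lerDl.
  have := ler_normD ((a - ratr q) *: x) (ratr q *: (x - comb s)).
  lra.
- move=> _ /eS[n <-]; apply/DP => r r0; exists [:: (1, n)].
  by rewrite /comb big_seq1 /= rmorph1 scale1r subrr normr0.
Qed.

End banach_separable.

(** * Norm and truncations in an l^2 sum *)

Section l2sum_basic.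
Context (R : realType) (V : nat -> normedModType R).
Implicit Types x y : l2sum V.

Lemma l2sum_ext x y : (forall n, x n = y n) -> x = y.
Proof.
case: x y => [x Px] [y Py] /= xy.
have {xy} e : x = y by apply: functional_extensionality_dep.
by subst y; rewrite (Prop_irrelevance Px Py).
Qed.

Lemma l2sum_sqr_norm x :
  ((`|x| ^+ 2)%:E = \sum_(0 <= n <oo) (`|x n| ^+ 2)%:E)%E.
Proof.
rewrite -[`|x|]/(l2sum_norm x) /l2sum_norm sqr_sqrtr; last first.
  by rewrite fine_ge0// nneseries_ge0// => n _ _; rewrite lee_fin sqr_ge0.
rewrite fineK// ge0_fin_numE ?l2sum_finite//.
by rewrite nneseries_ge0// => n _ _; rewrite lee_fin sqr_ge0.
Qed.

Lemma l2sum_sqr_norm_le x c :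
  (forall N, \sum_(0 <= n < N) `|x n| ^+ 2 <= c) -> `|x| ^+ 2 <= c.
Proof.
move=> H; rewrite -lee_fin l2sum_sqr_norm; apply: lime_le.
  by apply: is_cvg_nneseries => n _ _; rewrite lee_fin sqr_ge0.
by apply: nearW => N; rewrite sumEFin lee_fin.
Qed.

Lemma l2sum_partial_le x N : \sum_(0 <= n < N) `|x n| ^+ 2 <= `|x| ^+ 2.
Proof.
rewrite -lee_fin l2sum_sqr_norm -sumEFin; apply: nneseries_lim_ge => n _ _.
by rewrite lee_fin sqr_ge0.
Qed.

(** The bound on partial sums is the form in which square summability is obtained
    everywhere below, from limits or from explicit estimates. *)
Lemma l2sum_mk (u : forall n, V n) c :
  (forall N, \sum_(0 <= n < N) `|u n| ^+ 2 <= c) ->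
  exists2 x : l2sum V, (forall n, x n = u n) & `|x| ^+ 2 <= c.
Proof.
move=> H; have fin : (\sum_(0 <= n <oo) (`|u n| ^+ 2)%:E < +oo)%E.
  apply: (@le_lt_trans _ _ c%:E); last by rewrite ltry.
  apply: lime_le; first by apply: is_cvg_nneseries => n _ _; rewrite lee_fin sqr_ge0.
  by apply: nearW => N; rewrite sumEFin lee_fin.
by exists (L2sum fin) => //; exact: l2sum_sqr_norm_le.
Qed.

Lemma l2sum_coord_le x n : `|x n| <= `|x|.
Proof.
rewrite -(ler_pXn2r (n:=2))// ?nnegrE//.
apply: le_trans (l2sum_partial_le x n.+1).
by rewrite big_nat_recr//= lerDr; apply: sumr_ge0 => i _; exact: sqr_ge0.
Qed.

(** Half of the theorem of Pythagoras, from the comparison of partial sums. *)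
Lemma l2sum_disjoint_norm x y : (forall n, x n = 0 \/ y n = 0) ->
  `|x + y| ^+ 2 <= `|x| ^+ 2 + `|y| ^+ 2.
Proof.
move=> xy; apply: l2sum_sqr_norm_le => N.
apply: le_trans (lerD (l2sum_partial_le x N) (l2sum_partial_le y N)).
rewrite -big_split/=; apply: ler_sum => n _.
by have [->|->] := xy n; rewrite ?add0r ?addr0 normr0 expr0n ?add0r ?addr0.
Qed.

Lemma l2sum_trunc_subproof N x :
  exists2 y : l2sum V, (forall n, y n = if (n < N)%N then x n else 0) &
    `|y| ^+ 2 <= `|x| ^+ 2.
Proof.
apply: l2sum_mk => M; apply: le_trans (l2sum_partial_le x M).
apply: ler_sum => n _; case: ifPn => // _.
by rewrite normr0 expr0n sqr_ge0.
Qed.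

Definition l2sum_trunc N x := s2val (cid2 (l2sum_trunc_subproof N x)).

Lemma l2sum_truncE N x n :
  l2sum_trunc N x n = if (n < N)%N then x n else 0.
Proof. exact: (s2valP (cid2 (l2sum_trunc_subproof N x))). Qed.

Lemma l2sum_trunc_le N x : `|l2sum_trunc N x| <= `|x|.
Proof.
rewrite -(ler_pXn2r (n:=2))// ?nnegrE//.
exact: (s2valP' (cid2 (l2sum_trunc_subproof N x))).
Qed.

Lemma l2sum_subtruncE N x n :
  x n - l2sum_trunc N x n = if (n < N)%N then 0 else x n.
Proof.
rewrite l2sum_truncE.
by case: ifP; rewrite ?subrr ?subr0.
Qed.

Lemma l2sum_subtrunc_le N x : `|x - l2sum_trunc N x| <= `|x|.
Proof.
rewrite -(ler_pXn2r (n:=2))// ?nnegrE//; apply: l2sum_sqr_norm_le => M.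
apply: le_trans (l2sum_partial_le x M); apply: ler_sum => n _.
by rewrite /= l2sum_subtruncE; case: ifPn => // _; rewrite normr0 expr0n sqr_ge0.
Qed.

Lemma l2sum_tail x (e : R) : 0 < e -> exists N, `|x - l2sum_trunc N x| <= e.
Proof.
move=> e0.
have [N NP] : exists N, `|x| ^+ 2 - e ^+ 2 < \sum_(0 <= n < N) `|x n| ^+ 2.
  apply: contrapT => /forallNP H.
  have : `|x| ^+ 2 <= `|x| ^+ 2 - e ^+ 2.
    by apply: l2sum_sqr_norm_le => N; rewrite leNgt; apply/negP; exact: H.
  by rewrite leNgt ltrBlDr ltrDl exprn_gt0.
exists N; rewrite -(ler_pXn2r (n:=2))// ?nnegrE ?(ltW e0)//.
apply: l2sum_sqr_norm_le => M.
have : \sum_(0 <= n < M) `|(x - l2sum_trunc N x) n| ^+ 2 <=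
    \sum_(N <= n < N + M) `|x n| ^+ 2.
  have [MN|NM] := leqP M N.
    rewrite big_nat big1; last first.
      move=> n /andP[_ nM]; rewrite /= l2sum_subtruncE (leq_trans nM MN).
      by rewrite normr0 expr0n.
    by apply: sumr_ge0 => n _; exact: sqr_ge0.
  rewrite (big_cat_nat (n:=N))//= ?(ltnW NM)// [X in X + _]big_nat.
  rewrite big1 ?add0r; last first.
    by move=> n /andP[_ nM]; rewrite /= l2sum_subtruncE nM normr0 expr0n.
  rewrite (big_cat_nat (n:=M) (p:=N + M))//= ?leq_addl ?(ltnW NM)//.
  rewrite -[leLHS]addr0 lerD//; last by apply: sumr_ge0 => n _; exact: sqr_ge0.
  rewrite big_nat [leRHS]big_nat; apply: ler_sum => n /andP[Nn _].
  by rewrite /= l2sum_subtruncE ltnNge Nn.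
have := l2sum_partial_le x (N + M).
rewrite (big_cat_nat (n:=N))//= ?leq_addr//.
lra.
Qed.

End l2sum_basic.

(** * Inclusion of the summands *)

Section l2sum_incl.
Context (R : realType) (V : nat -> normedModType R).
Implicit Types x y : l2sum V.

(** The components live in different types, so the index has to be transported
    along n = m. *)
Definition coord_fun n (v : V n) : forall m, V m := fun m =>
  match pselect (n = m) with
  | left e => eq_rect n (fun k => V k : Type) v m e
  | right _ => 0
  end.

Lemma coord_fun_same n (v : V n) : coord_fun v n = v.
Proof.
rewrite /coord_fun; case: pselect => [e|/(_ erefl)//].
by rewrite (Prop_irrelevance e erefl).
Qed.

Lemma coord_fun_diff n (v : V n) m : n <> m -> coord_fun v m = 0.
Proof. by rewrite /coord_fun; case: pselect. Qed.

Lemma l2sum_incl_subproof n (v : V n) :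
  exists2 x : l2sum V, (forall m, x m = coord_fun v m) & `|x| ^+ 2 <= `|v| ^+ 2.
Proof.
apply: l2sum_mk => N; have [nN|Nn] := ltnP n N.
  rewrite big_mkord (bigD1 (Ordinal nN))//= big1 ?addr0 ?coord_fun_same//.
  move=> i /eqP ni; rewrite coord_fun_diff ?normr0 ?expr0n// => nE.
  by apply: ni; apply: val_inj.
rewrite big_nat big1 ?sqr_ge0// => m /andP[_ mN].
rewrite coord_fun_diff ?normr0 ?expr0n// => nm.
by move: mN; rewrite -nm ltnNge Nn.
Qed.

Definition l2sum_incl n (v : V n) := s2val (cid2 (l2sum_incl_subproof v)).

Lemma l2sum_inclE n (v : V n) m : l2sum_incl v m = coord_fun v m.
Proof. exact: (s2valP (cid2 (l2sum_incl_subproof v))). Qed.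

Lemma l2sum_incl_le n (v : V n) : `|l2sum_incl v| <= `|v|.
Proof.
rewrite -(ler_pXn2r (n:=2))// ?nnegrE//.
exact: (s2valP' (cid2 (l2sum_incl_subproof v))).
Qed.

Lemma l2sum_inclP n a (v w : V n) :
  l2sum_incl (a *: v + w) = a *: l2sum_incl v + l2sum_incl w.
Proof.
apply: l2sum_ext => m /=; rewrite !l2sum_inclE.
have [nm|nm] := pselect (n = m); last by rewrite !coord_fun_diff// scaler0 addr0.
by subst m; rewrite !coord_fun_same.
Qed.

Lemma l2sum_inclB n (v w : V n) :
  l2sum_incl (v - w) = l2sum_incl v - l2sum_incl w.
Proof. by rewrite addrC -scaleN1r l2sum_inclP scaleN1r addrC. Qed.

Lemma l2sum_sumE N (u : 'I_N -> l2sum V) n : (\sum_i u i) n = \sum_i u i n.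
Proof. exact: (big_morph (fun x : l2sum V => x n)). Qed.

Lemma l2sum_trunc_sum N x : l2sum_trunc N x = \sum_(n < N) l2sum_incl (x n).
Proof.
apply: l2sum_ext => m; rewrite l2sum_sumE l2sum_truncE.
case: ifPn => [mN|].
  rewrite (bigD1 (Ordinal mN))//= l2sum_inclE coord_fun_same big1 ?addr0// => i /eqP im.
  by rewrite l2sum_inclE coord_fun_diff// => e; apply: im; exact: val_inj.
rewrite -leqNgt => Nm; rewrite big1// => i _.
rewrite l2sum_inclE coord_fun_diff// => e.
by have := ltn_ord i; rewrite e ltnNge Nm.
Qed.

End l2sum_incl.

(** * Separability and strict convexity of an l^2 sum *)

(** Separability phrased through closed subspaces, which passes easily from the
    summands to an l^2 sum. *)
Definition countably_total (R : realType) (X : normedModType R) :=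
  exists2 S : set X, countable S &
  forall M : set X, closed M -> M 0 ->
    (forall a x y, M x -> M y -> M (a *: x + y)) -> S `<=` M -> forall x, M x.

Section l2sum_geometry.
Context (R : realType) (V : nat -> normedModType R).
Implicit Types x y : l2sum V.

Lemma l2sum_countably_total :
  (forall n, countably_total (V n)) -> countably_total (l2sum V).
Proof.
move=> H; pose S n := s2val (cid2 (H n)).
exists (\bigcup_n (@l2sum_incl _ V n @` S n)).
  apply: bigcup_countable => // n _.
  exact: card_le_trans (card_image_le _ _) (s2valP (cid2 (H n))).
move=> M cM M0 MP SM.
have MI n (v : V n) : M (l2sum_incl v).
  have incl0 : l2sum_incl (0 : V n) = 0 by rewrite -[0](subrr 0) l2sum_inclB subrr.
  have := s2valP' (cid2 (H n)) [set v | M (l2sum_incl v)].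
  apply=> [{}v cv|||{}v Sv] /=; rewrite ?incl0//.
  - apply: cM => A /nbhs_ballP[e /= e0 eA].
    have [w [Mw]] := cv _ (nbhsx_ballx v e e0).
    rewrite -ball_normE/= => vw; exists (l2sum_incl w); split=> //; apply: eA.
    rewrite -ball_normE/= -l2sum_inclB; exact: le_lt_trans (l2sum_incl_le _) vw.
  - by move=> a x y Mx My; rewrite /= l2sum_inclP; exact: MP.
  - by apply: SM; exists n => //; exists v.
move=> x; apply: cM => A /nbhs_ballP[e /= e0 eA].
have [N NP] := l2sum_tail x (divr_gt0 e0 (ltr0n _ 2)).
exists (l2sum_trunc N x); split.
  rewrite l2sum_trunc_sum; elim/big_ind: _ => // y z My Mz.
  by rewrite -[y]scale1r; exact: MP.
apply: eA; rewrite -ball_normE/=; apply: le_lt_trans NP _.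
by rewrite ltr_pdivrMr// ltr_pMr// ltr1n.
Qed.

(** In a component where x and y differ, the square of the norm of the midpoint is
    strictly below the mean of the squares: by the parallelogram identity for real
    numbers if the two norms differ, by strict convexity of the component if they
    agree. Elsewhere the inequality is weak. *)
Lemma l2sum_strictly_convex :
  (forall n, strictly_convex (V n)) -> strictly_convex (l2sum V).
Proof.
move=> Vsc.
have mid_gap n (v w : V n) : `|2^-1 *: (v + w)| ^+ 2 <=
    (`|v| ^+ 2 + `|w| ^+ 2) / 2 - ((`|v| - `|w|) / 2) ^+ 2.
  have h : `|2^-1 *: (v + w)| <= (`|v| + `|w|) / 2.
    rewrite normrZ ger0_norm// mulrC ler_wpM2r//; exact: ler_normD.
  have -> : (`|v| ^+ 2 + `|w| ^+ 2) / 2 - ((`|v| - `|w|) / 2) ^+ 2 =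
    ((`|v| + `|w|) / 2) ^+ 2 by field.
  by rewrite lerXn2r ?nnegrE// divr_ge0// addr_ge0.
have mid n (v w : V n) : `|2^-1 *: (v + w)| ^+ 2 <= (`|v| ^+ 2 + `|w| ^+ 2) / 2.
  by apply: le_trans (mid_gap n v w) _; rewrite gerBl sqr_ge0.
have mid_lt n (v w : V n) : v != w ->
    `|2^-1 *: (v + w)| ^+ 2 < (`|v| ^+ 2 + `|w| ^+ 2) / 2.
  move=> vw.
  have [vwE|] := eqVneq `|v| `|w|; last first.
    rewrite -subr_eq0 => vw0; apply: le_lt_trans (mid_gap n v w) _.
    by rewrite ltrBlDr ltrDl exprn_even_gt0//= mulf_neq0.
  have v0 : v != 0.
    apply/eqP => v0; move: vwE vw; rewrite v0 normr0 => /esym/eqP.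
    by rewrite normr_eq0 eq_sym => /eqP ->; rewrite eqxx.
  have nv0 : 0 < `|v| by rewrite normr_gt0.
  have := Vsc n (`|v|^-1 *: v) (`|v|^-1 *: w).
  rewrite -scalerDr scalerA mulrC -scalerA !normrZ normfV normr_id vwE.
  rewrite vwE in nv0.
  rewrite !mulVf ?gt_eqF// => /(_ _ erefl erefl).
  rewrite ltr_pdivrMl// mulr1 -vwE => H.
  have {}H : `|2^-1| * `|v + w| < `|w|.
    rewrite vwE in H; apply: H; apply: contra vw => /eqP vw.
    by apply/eqP; apply: scalerI vw; rewrite invr_eq0 gt_eqF.
  have : 0 <= `|2^-1| * `|v + w| by rewrite mulr_ge0.
  rewrite vwE; nra.
move=> x y xy x1 y1.
have [n /eqP xyn] : exists n, x n <> y n.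
  by apply/existsNP => H; move/eqP: xy; apply; exact: l2sum_ext.
pose g n := (`|x n| ^+ 2 + `|y n| ^+ 2) / 2 - `|2^-1 *: (x n + y n)| ^+ 2.
have g0 k : 0 <= g k by rewrite subr_ge0; exact: mid.
have gn : 0 < g n by rewrite subr_gt0; exact: mid_lt.
have : `|2^-1 *: (x + y)| ^+ 2 <= 1 - g n.
  apply: l2sum_sqr_norm_le => N.
  have := l2sum_partial_le x (N + n.+1); have := l2sum_partial_le y (N + n.+1).
  rewrite x1 y1 !expr1n => hy hx.
  have : g n <= \sum_(0 <= k < N + n.+1) g k.
    rewrite big_mkord (bigD1 (Ordinal (_ : n < N + n.+1)%N)) ?leq_addl//= => ?.
    by rewrite lerDl; apply: sumr_ge0.
  have : \sum_(0 <= k < N + n.+1) g k = (\sum_(0 <= k < N + n.+1) `|x k| ^+ 2 +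
      \sum_(0 <= k < N + n.+1) `|y k| ^+ 2) / 2 -
      \sum_(0 <= k < N + n.+1) `|2^-1 *: (x k + y k)| ^+ 2.
    by rewrite -big_split/= mulr_suml -sumrB.
  have : \sum_(0 <= k < N) `|2^-1 *: (x k + y k)| ^+ 2 <=
      \sum_(0 <= k < N + n.+1) `|2^-1 *: (x k + y k)| ^+ 2.
    rewrite [leRHS](big_cat_nat (n:=N))//= ?leq_addr// lerDl.
    by apply: sumr_ge0 => i _; exact: sqr_ge0.
  rewrite /=; lra.
move=> h; rewrite -(ltr_pXn2r (n:=2))// ?nnegrE// expr1n.
by apply: le_lt_trans h _; rewrite ltrBlDr ltrDl.
Qed.

End l2sum_geometry.

(** * Completeness and reflexivity of an l^2 sum *)

Lemma choice_dep (I : Type) (T : I -> Type) (P : forall i, T i -> Prop) :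
  (forall i, exists x, P i x) -> exists f : forall i, T i, forall i, P i (f i).
Proof. by move=> H; exists (fun i => sval (cid (H i))) => i; exact: svalP. Qed.

Section l2sum_banach.
Context (R : realType) (V : nat -> normedModType R).
Implicit Types x y : l2sum V.

Lemma geometric_dist (X : normedModType R) (u : nat -> X) :
  (forall n, `|u n.+1 - u n| <= 2^-1 ^+ n) ->
  forall m k, `|u (m + k)%N - u m| <= 2 * 2^-1 ^+ m.
Proof.
move=> H m k.
suff : `|u (m + k)%N - u m| <= 2 * 2^-1 ^+ m - 2 * 2^-1 ^+ (m + k).
  by move=> h; apply: le_trans h _; rewrite gerBl mulr_ge0// exprn_ge0.
elim: k => [|k IH]; first by rewrite addn0 !subrr normr0.
have -> : u (m + k.+1)%N - u m = (u (m + k).+1 - u (m + k)%N) + (u (m + k)%N - u m).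
  by rewrite addnS addrA subrK.
apply: le_trans (ler_normD _ _) _.
by move: (H (m + k)%N) IH; rewrite addnS exprSr; lra.
Qed.

Lemma half_expr_small (e : R) : 0 < e -> exists n, 2 * 2^-1 ^+ n < e.
Proof.
move=> e0; have e20 : 0 < e / 2 by rewrite divr_gt0.
have /cvgrPdist_lt/(_ _ e20) H := @half_expr_cvg R.
have [n /=] := @filter_ex _ _ _ _ H.
rewrite sub0r normrN ger0_norm ?exprn_ge0//.
by exists n; rewrite mulrC -ltr_pdivlMr.
Qed.

(** Coordinatewise limits exist; the distance bounds pass to the limit on partial
    sums, hence on the whole norm. *)
Lemma l2sum_banach : (forall n, banach_space (V n)) -> banach_space (l2sum V).
Proof.
move=> Vb; apply: banach_criterion => u uP.
have uD := geometric_dist uP.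
have /choice_dep[l lP] : forall n, exists l : V n, u k n @[k --> \oo] --> l.
  move=> n.
  suff /Vb/cvg_ex : cauchy (u k n @[k --> \oo]) by [].
  apply: cauchy_exP => e e0; have [m me] := half_expr_small e0.
  exists (u m n); exists m => // k /= mk.
  rewrite -ball_normE/= distrC; apply: le_lt_trans me.
  apply: le_trans (l2sum_coord_le (u k - u m) n) _.
  by rewrite -(subnKC mk).
have bound m N : \sum_(0 <= n < N) `|l n - u m n| ^+ 2 <= (2 * 2^-1 ^+ m) ^+ 2.
  have cv : \sum_(0 <= n < N) `|u k n - u m n| ^+ 2 @[k --> \oo] -->
      \sum_(0 <= n < N) `|l n - u m n| ^+ 2.
    apply: cvg_big => [|n _]; first exact: add_continuous.
    have h : `|u k n - u m n| @[k --> \oo] --> `|l n - u m n|.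
      by apply: cvg_norm; apply: (cvgB (lP n)); exact: cvg_cst.
    by apply: cvgM.
  apply: (cvgr_to_le cv); exists m => // k /= mk.
  apply: le_trans (l2sum_partial_le (u k - u m) N) _.
  rewrite -[in leLHS](subnKC mk).
  by rewrite lerXn2r ?nnegrE ?mulr_ge0 ?exprn_ge0.
have [w wE _] := l2sum_mk (bound 0).
have LE n : (w + u 0) n = l n by rewrite /= wE subrK.
apply/cvg_ex; exists (w + u 0); apply/cvgrPdist_lt => e e0.
have [m me] := half_expr_small e0.
near=> k.
have mk : (m <= k)%N by near: k; exists m.
have : `|w + u 0 - u k| <= 2 * 2^-1 ^+ k.
  rewrite -(ler_pXn2r (n:=2))// ?nnegrE ?mulr_ge0 ?exprn_ge0//.
  apply: l2sum_sqr_norm_le => N; apply: le_trans (bound k N).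
  by apply: ler_sum => n _; rewrite -LE.
move=> h; apply: le_lt_trans h (le_lt_trans _ me).
by rewrite ler_wpM2l// ler_wiXn2l ?invf_le1 ?ler1n.
Unshelve. all: by end_near. Qed.

End l2sum_banach.

Section l2sum_reflexive.
Context (R : realType) (V : nat -> normedModType R).
Implicit Types x y : l2sum V.

Lemma l2sum_pullback_subproof j (h : dual (V j)) :
  exists2 f : dual (l2sum V), (f =1 fun x => h (x j)) & `|f| <= `|h|.
Proof.
apply: bounded_dual => // [a x y|x]; first by rewrite dualP.
by apply: le_trans (ler_dual _ _) _; rewrite ler_wpM2l// l2sum_coord_le.
Qed.

Definition l2sum_pullback j (h : dual (V j)) : dual (l2sum V) :=
  s2val (cid2 (l2sum_pullback_subproof h)).

Lemma l2sum_pullbackE j (h : dual (V j)) x : l2sum_pullback h x = h (x j).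
Proof. exact: (s2valP (cid2 (l2sum_pullback_subproof h))). Qed.

Lemma l2sum_pullback_le j (h : dual (V j)) : `|l2sum_pullback h| <= `|h|.
Proof. exact: (s2valP' (cid2 (l2sum_pullback_subproof h))). Qed.

Lemma dual_incl j (f : dual (l2sum V)) :
  exists h : dual (V j), forall v, h v = f (l2sum_incl v).
Proof.
have [|||h hE _] := @bounded_dual R (V j) (fun v => f (l2sum_incl v)) `|f|.
- by move=> a v w; rewrite l2sum_inclP dualP.
- by [].
- move=> v; apply: le_trans (ler_dual _ _) _; rewrite ler_wpM2l//.
  exact: l2sum_incl_le.
by exists h.
Qed.

(** If z nearly norms f and is supported on [0, N[, and y is a unit vector
    supported off [0, N[, then |z + t y|^2 <= 1 + t^2, so f z + t f y exceeds |f|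
    by a term quadratic in t at most, which forces f y to be small. *)
Lemma dual_l2sum_tail (f : dual (l2sum V)) (e : R) : 0 < e -> exists N,
  forall y, (forall n, (n < N)%N -> y n = 0) -> `|f y| <= e * `|y|.
Proof.
move=> e0.
(* With z normed up to t e / 2, the argument gives f y <= |f| t + e / 2, which is at
   most e by the choice of t. *)
pose t := Num.min 1 (e / (2 * (`|f| + 1))).
have f1 : 0 < 2 * (`|f| + 1) by rewrite mulr_gt0// ltr_wpDl.
have t0 : 0 < t by rewrite lt_min ltr01/= divr_gt0.
have te : t * (2 * (`|f| + 1)) <= e by rewrite -ler_pdivlMr// ge_min lexx orbT.
have te0 : 0 < t * e / 4 by rewrite divr_gt0// mulr_gt0.
have [z z1 zf] := near_norming f te0.
have f2 : 0 < `|f| + 1 by rewrite ltr_wpDl.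
have [N NP] := l2sum_tail z (divr_gt0 te0 f2).
exists N.
have key y : (forall n, (n < N)%N -> y n = 0) -> `|y| <= 1 -> f y <= e.
  move=> yN y1.
  pose z' := l2sum_trunc N z.
  have z'1 : `|z'| <= 1 by apply: le_trans (l2sum_trunc_le N z) z1.
  have fz' : `|f| - t * e / 2 <= f z'.
    have := ler_norm (f (z - z')); have := ler_dual f (z - z').
    rewrite dualB; move: NP; rewrite ler_pdivlMr// -/z' => h1.
    have := normr_ge0 (z - z'); nra.
  have : `|z' + t *: y| ^+ 2 <= (1 + t ^+ 2) ^+ 2.
    apply: le_trans (l2sum_disjoint_norm _) _.
      move=> n; rewrite l2sum_truncE; case: ifPn => nN; [right|by left].
      by rewrite /= yN// scaler0.
    rewrite normrZ (gtr0_norm t0) exprMn.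
    have : `|z'| ^+ 2 <= 1 by rewrite expr_le1.
    have : `|y| ^+ 2 <= 1 by rewrite expr_le1.
    have : 0 <= t ^+ 2 by exact: sqr_ge0.
    move: (t ^+ 2) (`|y| ^+ 2) (`|z'| ^+ 2) => T Y Z; nra.
  rewrite ler_pXn2r ?nnegrE ?addr_ge0 ?sqr_ge0// => zy.
  have := ler_norm (f (z' + t *: y)); have := ler_dual f (z' + t *: y).
  have : `|f| * `|z' + t *: y| <= `|f| * (1 + t ^+ 2) by rewrite ler_wpM2l.
  rewrite dualD dualZ => h1 h2 h3.
  have h4 : t * f y <= t * (`|f| * t + e / 2) by nra.
  move: h4; rewrite ler_pM2l//; nra.
move=> y yN; have [->|y0] := eqVneq y 0; first by rewrite dual0 !normr0 mulr0.
have ny0 : 0 < `|y| by rewrite normr_gt0.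
have nyy : `| `|y|^-1 *: y| <= 1 by rewrite normrZ normfV normr_id mulVf ?gt_eqF.
have h1 : f (`|y|^-1 *: y) <= e.
  by apply: key => // n nN; rewrite /= yN// scaler0.
have h2 : f (- (`|y|^-1 *: y)) <= e.
  by apply: key => [n nN|]; rewrite ?normrN//= yN// scaler0 oppr0.
rewrite -ler_pdivrMr// -(gtr0_norm ny0) -normfV -normrM mulrC -dualZ.
by rewrite ler_norml lerNl -dualN h1 h2.
Qed.

(** Phi induces functionals on the duals of the components, represented by vectors
    u j. Their square sums are bounded by applying Goldstine's theorem to
    functionals that nearly norm finitely many of the u j: the vector y it provides
    in the unit ball satisfies |u j| <= |y j| + 2 e. The vector x so obtained
    represents Phi on functionals depending on finitely many coordinates, and these
    are dense by [dual_l2sum_tail]. *)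
Lemma l2sum_norm_reflexive :
  (forall n, norm_reflexive (V n)) -> norm_reflexive (l2sum V).
Proof.
move=> Vr; apply: norm_reflexive_unit => Phi Phi1.
have /choice_dep[u uP] : forall j, exists v : V j,
    (forall h : dual (V j), Phi (l2sum_pullback h) = h v) /\
    (forall e : R, 0 < e -> exists2 h : dual (V j), `|h| <= 1 & `|v| - e < h v).
  move=> j.
  have [|||Phij PhijE _] := @bounded_dual R (dual (V j))
      (fun h => Phi (l2sum_pullback h)) `|Phi|.
  - move=> a h k; rewrite -dualP; congr (Phi _); apply: dual_ext => x /=.
    by rewrite !l2sum_pullbackE.
  - by [].
  - move=> h; apply: le_trans (ler_dual _ _) _; rewrite ler_wpM2l//.
    exact: l2sum_pullback_le.
  have [v vE vn] := Vr j Phij.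
  exists v; split=> [h|e e0]; first by rewrite -vE PhijE.
  have [h h1 hP] := near_norming Phij e0.
  by exists h => //; rewrite -vE; apply: le_lt_trans hP; rewrite lerD2r.
have uN N : \sum_(0 <= n < N) `|u n| ^+ 2 <= 1.
  apply/ler_addgt0Pr => e0 e00.
  (* The error is 2 e for each of the N norms, hence at most 8 e for each square, as
     the norms of the y j and e are at most 1. *)
  pose e := Num.min 1 (e0 / (8 * N%:R + 1)).
  have N8 : 0 < 8 * N%:R + 1 :> R by rewrite ltr_wpDl// mulr_ge0.
  have e1 : e <= 1 by rewrite ge_min lexx.
  have egt0 : 0 < e by rewrite lt_min ltr01/= divr_gt0.
  have ee0 : e * (8 * N%:R + 1) <= e0 by rewrite -ler_pdivlMr// ge_min lexx orbT.
  have /choice_dep[h hP] : forall j, exists h : dual (V j),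
      `|h| <= 1 /\ `|u j| - e < h (u j).
    by move=> j; have [h] := (uP j).2 e egt0; exists h.
  have Phi1' : `|Phi| <= 1 by rewrite Phi1.
  have [y y1 yP] := goldstine (fun i : 'I_N => l2sum_pullback (h i)) Phi1' egt0.
  have uy (i : 'I_N) : `|u i| <= `|y i| + 2 * e.
    have := yP i; rewrite (uP i).1 l2sum_pullbackE ler_norml => /andP[_].
    have [h1 h2] := hP i.
    have := ler_norm (h i (y i)); have := ler_dual (h i) (y i).
    have : `|h i| * `|y i| <= `|y i| by rewrite ler_piMl.
    lra.
  have : \sum_(0 <= n < N) `|u n| ^+ 2 <= \sum_(0 <= n < N) (`|y n| ^+ 2 + 8 * e).
    rewrite !big_mkord; apply: ler_sum => i _.
    have := uy i; have : `|y i| <= 1 by exact: le_trans (l2sum_coord_le y i) y1.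
    have := normr_ge0 (y i); have := normr_ge0 (u i).
    move: (`|u i|) (`|y i|) => a b a0 b0 b1 ab.
    have : a ^+ 2 <= (b + 2 * e) ^+ 2.
      by rewrite lerXn2r ?nnegrE// addr_ge0// mulr_ge0// ltW.
    nra.
  rewrite big_split/= sumr_const_nat subn0 -mulr_natr.
  have := l2sum_partial_le y N.
  have : `|y| ^+ 2 <= 1 by rewrite expr_le1.
  nra.
have [x xE x1] := l2sum_mk uN.
exists x; last by rewrite -(expr_le1 (n:=2)).
move=> f; apply/eqP; rewrite -subr_eq0 -normr_le0; apply/ler_addgt0Pl => e0 e00.
rewrite addr0; have [e [e_gt0 ee0]] : exists e, 0 < e /\ 2 * e <= e0.
  by exists (e0 / 2); split; [rewrite divr_gt0|rewrite mulrC divfK].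
have {}x1 : `|x| <= 1 by rewrite -(expr_le1 (n:=2)).
have [N NP] := dual_l2sum_tail f e_gt0.
have /choice_dep[h hE] j := dual_incl j f.
pose g : dual (l2sum V) := \sum_(i < N) l2sum_pullback (h i).
have gE y : g y = f (l2sum_trunc N y).
  rewrite dual_sumE l2sum_trunc_sum dual_sum; apply: eq_bigr => i _.
  by rewrite l2sum_pullbackE hE.
have fg : `|f - g| <= e.
  apply: dual_norm_le => y y1.
  rewrite -[(f - g) y]/(f y - g y) gE -dualB.
  apply: le_trans (ler_norm _) _; apply: le_trans (NP _ _) _.
    by move=> n nN; rewrite /= l2sum_subtruncE nN.
  rewrite -[leRHS]mulr1 ler_wpM2l ?(ltW e_gt0)//.
  exact: le_trans (l2sum_subtrunc_le N y) y1.
have Phig : Phi g = g x.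
  rewrite dual_sum dual_sumE; apply: eq_bigr => i _.
  by rewrite (uP i).1 l2sum_pullbackE xE.
have -> : Phi f - f x = Phi (f - g) - (f - g) x.
  by rewrite dualB Phig -[(f - g) x]/(f x - g x) opprB addrA subrK.
apply: le_trans (ler_normB _ _) _; apply: le_trans ee0.
have := ler_dual Phi (f - g); have := ler_dual (f - g) x.
rewrite Phi1 mul1r.
have : `|f - g| * `|x| <= `|f - g| by rewrite ler_piMr.
lra.
Qed.

End l2sum_reflexive.

(** * L^p spaces with an even exponent *)

Lemma even_expr_ge0 (R : realDomainType) n (x : R) : 0 <= x ^+ (2 * n).
Proof. by rewrite exprM exprn_ge0// sqr_ge0. Qed.

Lemma measurable_EFin_expr d (T : measurableType d) (R : realType) (u : T -> R) {n : nat} :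
  measurable_fun [set: T] u ->
  measurable_fun [set: T] (fun x => (u x ^+ n)%:E).
Proof.
by move=> mu_; apply/measurable_EFinP; exact: measurable_funX.
Qed.

(** Superadditivity of powers; with exponent m.+1 and squares in place of u and v
    this is the inequality behind Clarkson's. *)
Lemma ler_exprD (R : realDomainType) k (u v : R) : 0 <= u -> 0 <= v ->
  u ^+ k.+1 + v ^+ k.+1 <= (u + v) ^+ k.+1.
Proof.
move=> u0 v0; elim: k => [|k IH]; first by rewrite !expr1.
rewrite [X in _ <= X]exprS; apply: le_trans (_ : (u + v) * (u ^+ k.+1 + v ^+ k.+1) <= _).
  rewrite mulrDl !mulrDr -!exprS [X in _ <= X]addrACA.
  have : 0 <= u * v ^+ k.+1 by rewrite mulr_ge0// exprn_ge0.
  have : 0 <= v * u ^+ k.+1 by rewrite mulr_ge0// exprn_ge0.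
  lra.
by rewrite ler_wpM2l// addr_ge0.
Qed.

Lemma ler_expr_midpoint (R : realFieldType) k (u v : R) : 0 <= u -> 0 <= v ->
  ((u + v) / 2) ^+ k <= (u ^+ k + v ^+ k) / 2.
Proof.
move=> u0 v0; elim: k => [|k IH]; first by rewrite !expr0; lra.
rewrite exprS; apply: le_trans (_ : (u + v) / 2 * ((u ^+ k + v ^+ k) / 2) <= _).
  by rewrite ler_wpM2l// divr_ge0// addr_ge0.
rewrite !exprS.
have : 0 <= (u - v) * (u ^+ k - v ^+ k).
  have [uv|vu] := leP u v.
    by rewrite mulr_le0// subr_le0// lerXn2r.
  by rewrite mulr_ge0// subr_ge0 ?lerXn2r ?ltW// ?nnegrE.
move: (u ^+ k) (v ^+ k) => a b; nra.
Qed.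

Section even_Lspace.
Context d (T : measurableType d) (R : realType) (mu : {measure set T -> \bar R}).
Variable m : nat.
Local Notation K := (2 * m.+1)%N.
Local Notation V := (LspaceType mu (le1_even_exponent R m)).
Local Notation "f ~~ g" := ((f : T -> R) = g %[ae mu]) (at level 70).
Implicit Types f g h : V.

Let K0 : (K%:R : R) != 0.
Proof. by rewrite pnatr_eq0. Qed.

Let Kge0 (x : R) : 0 <= x ^+ K.
Proof. exact: even_expr_ge0. Qed.

Lemma abse_powR_even (x : R) : (`|x%:E| `^ K%:R)%E = (x ^+ K)%:E.
Proof.
by rewrite abse_EFin poweR_EFin powR_mulrn// exprM real_normK ?num_real// -exprM.
Qed.

Lemma Lnorm_even (u : T -> R) :
  ('N[mu]_(K%:R)%:E[EFin \o u] `^ K%:R)%E = (\int[mu]_x (u x ^+ K)%:E)%E.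
Proof.
by rewrite powR_Lnorm//; apply: eq_integral => x _; exact: abse_powR_even.
Qed.

Lemma Lspace_measurable f : measurable_fun [set: T] (Lspace_repr f : T -> R).
Proof. exact: measurable_funPT. Qed.

(** Elements of L^p are classes with an arbitrary representative; the
    norm computations below replace it by an explicit function through this lemma. *)
Lemma Lspace_norm_ae f (u : T -> R) : measurable_fun [set: T] u ->
  Lspace_repr f ~~ u -> ((`|f| ^+ K)%:E = \int[mu]_x (u x ^+ K)%:E)%E.
Proof.
move=> mu_ fu; rewrite -Lnorm_even.
rewrite -(ae_eq_Lnorm (le1_even_exponent R m) (Lspace_measurable f) mu_ fu).
have ffin := Lfunction_finite (le1_even_exponent R m) (Lspace_repr f).
rewrite -[`|f|]/(Lspace_norm f) /Lspace_norm.
have : (0 <= 'N[mu]_(K%:R)%:E[EFin \o Lspace_repr f])%E by exact: Lnorm_ge0.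
move: ffin; rewrite /finite_norm; case: ('N[_]__[_])%E => //= r _.
by rewrite lee_fin => r0; rewrite powR_mulrn.
Qed.

Lemma Lspace_mk (u : T -> R) : measurable_fun [set: T] u ->
  (\int[mu]_x (u x ^+ K)%:E < +oo)%E -> exists f : V, Lspace_repr f ~~ u.
Proof.
move=> mu_ ufin.
have uL : u \in Lfun mu (K%:R)%:E.
  apply/andP; split; rewrite inE//=.
  by rewrite /finite_norm; apply: (@lty_poweRy _ _ K%:R) => //; rewrite Lnorm_even.
exists (Lspace_pi (Lfun_Sub (le1_even_exponent R m) uL)).
exact: Lspace_piK.
Qed.

Lemma Lspace_integral_lty f : (\int[mu]_x (Lspace_repr f x ^+ K)%:E < +oo)%E.
Proof.
rewrite -(@Lspace_norm_ae f (Lspace_repr f)) ?ltry//.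
exact: ae_eq_refl.
Qed.

Lemma Lspace_reprD f g :
  Lspace_repr (f + g) ~~ (fun x => Lspace_repr f x + Lspace_repr g x).
Proof. exact: Lspace_piK. Qed.

Lemma Lspace_reprZ a f : Lspace_repr (a *: f) ~~ (fun x => a * Lspace_repr f x).
Proof. exact: Lspace_piK. Qed.

Lemma Lspace_reprN f : Lspace_repr (- f) ~~ (fun x => - Lspace_repr f x).
Proof. exact: Lspace_piK. Qed.

Lemma Lspace_repr0 : Lspace_repr (0 : V) ~~ (fun=> 0).
Proof. exact: Lspace_piK. Qed.

Lemma Lspace_reprB f g :
  Lspace_repr (f - g) ~~ (fun x => Lspace_repr f x - Lspace_repr g x).
Proof.
by apply: filterS2 (Lspace_reprD f (- g)) (Lspace_reprN g) => x h1 h2 _;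
  rewrite h1// h2.
Qed.

(** With u, v the half sum and the half difference, u^2m + v^2m <= (u^2 + v^2)^m,
    and u^2 + v^2 is the mean of a^2 and b^2; conclude by convexity of the power. *)
Lemma clarkson_pointwise (a b : R) :
  (2^-1 * (a + b)) ^+ K + (2^-1 * (a - b)) ^+ K <= 2^-1 * (a ^+ K + b ^+ K).
Proof.
rewrite !exprM.
apply: le_trans (ler_exprD _ (sqr_ge0 _) (sqr_ge0 _)) _.
have -> : (2^-1 * (a + b)) ^+ 2 + (2^-1 * (a - b)) ^+ 2 = (a ^+ 2 + b ^+ 2) / 2.
  by field.
by apply: le_trans (ler_expr_midpoint _ (sqr_ge0 _) (sqr_ge0 _)) _; rewrite mulrC.
Qed.

Lemma clarkson f g :
  `|2^-1 *: (f + g)| ^+ K + `|2^-1 *: (f - g)| ^+ K <=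
  2^-1 * (`|f| ^+ K + `|g| ^+ K).
Proof.
pose F : T -> R := Lspace_repr f; pose G : T -> R := Lspace_repr g.
have mF : measurable_fun [set: T] F := Lspace_measurable f.
have mG : measurable_fun [set: T] G := Lspace_measurable g.
have mD : measurable_fun [set: T] (fun x => 2^-1 * (F x + G x)).
  by apply: measurable_funM => //; exact: measurable_funD.
have mB : measurable_fun [set: T] (fun x => 2^-1 * (F x - G x)).
  by apply: measurable_funM => //; exact: measurable_funB.
rewrite -lee_fin EFinM !EFinD.
rewrite (@Lspace_norm_ae f F mF (ae_eq_refl _ _ _)).
rewrite (@Lspace_norm_ae g G mG (ae_eq_refl _ _ _)).
rewrite (@Lspace_norm_ae (2^-1 *: (f + g)) (fun x => 2^-1 * (F x + G x)))//; last first.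
  apply: filterS2 (Lspace_reprZ 2^-1 (f + g)) (Lspace_reprD f g) => x h1 h2 _.
  by rewrite h1// h2.
rewrite (@Lspace_norm_ae (2^-1 *: (f - g)) (fun x => 2^-1 * (F x - G x)))//; last first.
  apply: filterS2 (Lspace_reprZ 2^-1 (f - g)) (Lspace_reprB f g) => x h1 h2 _.
  by rewrite h1// h2.
rewrite -!ge0_integralD//; try (by move=> x _; rewrite lee_fin); try exact: measurable_EFin_expr.
rewrite -ge0_integralZl//; last 2 first.
- by apply: emeasurable_funD; exact: measurable_EFin_expr.
- by move=> x _; rewrite -EFinD lee_fin addr_ge0.
- apply: ge0_le_integral => //.
  + by move=> x _; rewrite -EFinD lee_fin addr_ge0.
  + by apply: emeasurable_funD; exact: measurable_EFin_expr.
  + apply: measurable_funeM; apply: emeasurable_funD; exact: measurable_EFin_expr.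
  + by move=> x _; rewrite -!EFinD -EFinM lee_fin; exact: clarkson_pointwise.
Qed.

(** Clarkson's inequality bounds |(f - g)/2|^K by 1 - |(f + g)/2|^K, and Bernoulli's
    inequality turns a lower bound 1 - dl on |(f + g)/2| into 1 - K dl on its power;
    whence the choice of dl. *)
Lemma Lspace_uniformly_convex : uniformly_convex V.
Proof.
move=> e e0; pose q := (e / 2) ^+ K.
have q0 : 0 < q by rewrite exprn_gt0// divr_gt0.
pose dl := Num.min 1 (q / (2 * K%:R)).
have K2 : 0 < 2 * K%:R :> R by rewrite mulr_gt0.
have dl0 : 0 < dl by rewrite lt_min ltr01/= divr_gt0.
have dl1 : dl <= 1 by rewrite ge_min lexx.
have dlq : dl * (2 * K%:R) <= q by rewrite -ler_pdivlMr// ge_min lexx orbT.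
exists dl => // f g f1 g1 fg.
have bern : 1 - K%:R * dl <= (1 - dl) ^+ K.
  elim: (K) => [|k IH]; first by rewrite expr0 mul0r subr0.
  rewrite exprS; apply: le_trans (_ : (1 - dl) * (1 - k%:R * dl) <= _).
    rewrite -natr1; have : 0 <= k%:R * dl * dl.
      by rewrite !mulr_ge0// ltW.
    lra.
  by rewrite ler_wpM2l// subr_ge0.
have fgK : (1 - dl) ^+ K <= `|2^-1 *: (f + g)| ^+ K.
  by rewrite lerXn2r ?nnegrE// subr_ge0.
have f1K : `|f| ^+ K <= 1 by rewrite expr_le1.
have g1K : `|g| ^+ K <= 1 by rewrite expr_le1.
have : `|2^-1 *: (f - g)| ^+ K < q by have := clarkson f g; lra.
rewrite normrZ ger0_norm// ltr_pXn2r ?nnegrE ?mulr_ge0 ?divr_ge0 ?(ltW e0)//.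
lra.
Qed.

Lemma Lspace_strictly_convex : strictly_convex V.
Proof.
move=> f g fg f1 g1; have := clarkson f g; rewrite f1 g1 !expr1n => h.
have : 0 < `|2^-1 *: (f - g)| ^+ K.
  by rewrite exprn_gt0// normr_gt0 scaler_eq0 negb_or subr_eq0 fg andbT.
move=> h0; rewrite -(ltr_pXn2r (n:=K))// ?nnegrE// expr1n; lra.
Qed.

Lemma Lspace_norm_le f (c : R) : 0 <= c ->
  (`|f| ^+ K <= c ^+ K) = (`|f| <= c).
Proof. by move=> c0; rewrite ler_pXn2r ?nnegrE. Qed.

Lemma Lspace_abs f : exists2 g : V, Lspace_repr g ~~ (fun x => `|Lspace_repr f x|) &
  `|g| = `|f|.
Proof.
have mf : measurable_fun [set: T] (fun x => `|Lspace_repr f x|).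
  by apply: measurableT_comp => //; exact: Lspace_measurable.
have eqK : (\int[mu]_x (`|Lspace_repr f x| ^+ K)%:E =
    \int[mu]_x (Lspace_repr f x ^+ K)%:E)%E.
  by apply: eq_integral => x _; rewrite exprM real_normK ?num_real// -exprM.
have [|g gE] := Lspace_mk mf; first by rewrite eqK; exact: Lspace_integral_lty.
exists g => //; have := Lspace_norm_ae mf gE.
rewrite eqK -(Lspace_norm_ae (Lspace_measurable f) (ae_eq_refl _ _ _)) => -[h].
by apply/eqP; rewrite eq_le -!Lspace_norm_le// h lexx.
Qed.

Lemma Lspace_repr_sum (v : nat -> V) n :
  Lspace_repr (\sum_(0 <= i < n) v i) ~~
  (fun x => \sum_(0 <= i < n) Lspace_repr (v i) x).
Proof.
elim: n => [|n IH].
  rewrite big_geq//; apply: filterS Lspace_repr0 => x h _.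
  by rewrite h// big_geq.
rewrite big_nat_recr//.
apply: filterS2 (Lspace_reprD (\sum_(0 <= i < n) v i) (v n)) IH => x h1 h2 _.
by rewrite h1// h2// big_nat_recr.
Qed.

Let sum_abs (v : nat -> V) n x : R := \sum_(0 <= i < n) `|Lspace_repr (v i) x|.

Let measurable_sum_abs v n : measurable_fun [set: T] (sum_abs v n).
Proof.
by apply: measurable_sum => i; apply: measurableT_comp.
Qed.

Let sum_abs_ge0 v n x : 0 <= sum_abs v n x.
Proof. by apply: sumr_ge0. Qed.

Let sum_abs_nd v x : {homo sum_abs v ^~ x : n k / (n <= k)%N >-> n <= k}.
Proof.
move=> n k nk; rewrite /sum_abs [leRHS](big_cat_nat (n:=n))//= lerDl.
exact: sumr_ge0.
Qed.

Let sum_absK_nd v x :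
  {homo (fun n => (sum_abs v n x ^+ K)%:E) : n k / (n <= k)%N >-> (n <= k)%E}.
Proof.
by move=> n k nk; rewrite lee_fin lerXn2r ?nnegrE//; exact: sum_abs_nd.
Qed.

(** Minkowski's inequality bounds the norms of the partial sums, and monotone
    convergence passes to the limit. Applied to a sequence, this shows that it
    converges absolutely almost everywhere; applied to its tails, it bounds the
    distance from the partial sums to the limit. *)
Lemma Lspace_integral_sum_abs (v : nat -> V) (C : R) : 0 <= C ->
  (forall n, \sum_(0 <= i < n) `|v i| <= C) ->
  (\int[mu]_x limn (fun n => (sum_abs v n x ^+ K)%:E) <= (C ^+ K)%:E)%E.
Proof.
move=> C0 vC.
rewrite monotone_convergence//; last 2 first.
- by move=> n; apply: measurable_EFin_expr; exact: measurable_sum_abs.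
- by move=> n x _; rewrite lee_fin.
apply: lime_le.
  apply: ereal_nondecreasing_is_cvgn => n k nk; apply: ge0_le_integral => //.
  - by move=> x _; rewrite lee_fin.
  - by apply: measurable_EFin_expr; exact: measurable_sum_abs.
  - by apply: measurable_EFin_expr; exact: measurable_sum_abs.
  - by move=> x _; exact: sum_absK_nd.
apply: nearW => n.
have [f fE fn] : exists2 f : V, Lspace_repr f ~~ sum_abs v n &
    `|f| <= \sum_(0 <= i < n) `|v i|.
  elim: n => [|n [f fE fn]].
    exists 0; last by rewrite normr0 big_geq.
    by apply: filterS Lspace_repr0 => x h _; rewrite h// /sum_abs big_geq.
  have [g gE gn] := Lspace_abs (v n).
  exists (f + g).
    apply: (filterS3 _ _ (Lspace_reprD f g) fE gE) => x h1 h2 h3 _.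
    by rewrite h1// h2// h3// /sum_abs big_nat_recr.
  by rewrite big_nat_recr//= -gn (le_trans (ler_normD _ _))// lerD.
rewrite -(Lspace_norm_ae (measurable_sum_abs v n) fE) lee_fin Lspace_norm_le//.
exact: le_trans fn (vC n).
Qed.

(** Riesz-Fischer: a series with summable norms converges absolutely almost
    everywhere, and its pointwise sum is the limit in norm. *)
Lemma Lspace_banach : banach_space V.
Proof.
apply: banach_criterion => u uP.
pose v i := u i.+1 - u i.
have sumv n N : \sum_(0 <= i < N) `|v (n + i)%N| <= 2 * 2^-1 ^+ n.
  suff : \sum_(0 <= i < N) `|v (n + i)%N| <= 2 * 2^-1 ^+ n - 2 * 2^-1 ^+ (n + N).
    by move=> h; apply: le_trans h _; rewrite gerBl mulr_ge0// exprn_ge0.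
  elim: N => [|N IH]; first by rewrite big_geq// addn0 subrr.
  rewrite big_nat_recr//= addnS exprSr.
  by move: (uP (n + N)%N) IH; rewrite -/(v _); lra.
pose w n i := v (n + i)%N.
pose L n x := limn (fun N => (sum_abs (w n) N x ^+ K)%:E).
have cL n x : cvgn (fun N => (sum_abs (w n) N x ^+ K)%:E).
  by apply: ereal_nondecreasing_is_cvgn; exact: sum_absK_nd.
have L_ge n x N : ((sum_abs (w n) N x ^+ K)%:E <= L n x)%E.
  apply: lime_ge; first exact: cL.
  by exists N => // k /= Nk; exact: sum_absK_nd.
have L0 n x : (0 <= L n x)%E by apply: le_trans (L_ge n x 0); rewrite lee_fin.
have mL n : measurable_fun [set: T] (L n).
  apply: (emeasurable_fun_cvg (fun N x => (sum_abs (w n) N x ^+ K)%:E)).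
    by move=> N; apply: measurable_EFin_expr; exact: measurable_sum_abs.
  by move=> x _; exact: cL.
have intL n : (\int[mu]_x L n x <= ((2 * 2^-1 ^+ n) ^+ K)%:E)%E.
  apply: Lspace_integral_sum_abs => [|N]; last exact: sumv.
  by rewrite mulr_ge0// exprn_ge0.
(* On A the series of the v i converges absolutely; off A, which is negligible,
   the partial sums are replaced by 0 so that the limit g is measurable. *)
pose A := [set x | L 0 x \is a fin_num].
have mA : measurable A.
  by rewrite -[A]setTI; apply: emeasurable_fin_num.
have aeA : {ae mu, forall x, A x}.
  have : mu.-integrable [set: T] (L 0).
    apply/integrableP; split => //.
    under eq_integral do rewrite gee0_abs//.
    by apply: le_lt_trans (intL 0) _; rewrite ltry.
  by move=> /integrable_ae => /(_ measurableT); apply: filterS => x; apply.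
pose S n x := \sum_(0 <= i < n) Lspace_repr (v i) x.
have mS n : measurable_fun [set: T] (S n).
  by apply: measurable_sum => i; exact: Lspace_measurable.
have cS x : A x -> cvgn (fun n => S n x).
  move=> Ax; apply: normed_cvg.
  apply: nondecreasing_is_cvgn; first exact: (sum_abs_nd (w 0) x).
  exists (fine (L 0 x) + 1) => _ [N _ <-].
  have : sum_abs (w 0) N x ^+ K <= fine (L 0 x).
    by rewrite -lee_fin fineK.
  rewrite -[X in _ -> X <= _]/(sum_abs (w 0) N x).
  set h := sum_abs _ _ _ => hL.
  have [h1|h1] := leP h 1.
    by apply: le_trans h1 _; rewrite lerDr; apply: le_trans hL.
  apply: le_trans (_ : h ^+ K <= _); first by rewrite ler_eXnr// ltW.
  by apply: le_trans hL _; rewrite lerDl.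
pose g x := limn (fun n => S n x * \1_A x).
have cS' x : cvgn (fun n => S n x * \1_A x).
  have [Ax|nAx] := pselect (A x).
    by rewrite indicE mem_set//; under eq_fun do rewrite mulr1; exact: cS.
  rewrite indicE memNset//; under eq_fun do rewrite mulr0; exact: is_cvg_cst.
have mg : measurable_fun [set: T] g.
  apply: (@measurable_fun_cvg _ _ _ _ (fun n x => S n x * \1_A x)).
    by move=> n; apply: measurable_funM => //; exact: measurable_indic.
  by move=> x _; exact: cS'.
(* On A, the n-th remainder is bounded by the sum of the absolute values of the
   tail, whose integral is controlled by intL n. *)
have gS n : (\int[mu]_x ((g x - S n x) ^+ K)%:E <= ((2 * 2^-1 ^+ n) ^+ K)%:E)%E.
  apply: le_trans (intL n); apply: ae_ge0_le_integral => //.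
  - by move=> x _; rewrite lee_fin.
  - by apply: measurable_EFin_expr; exact: measurable_funB.
  apply: filterS aeA => x Ax _.
  have Sg : S N x @[N --> \oo] --> g x.
    rewrite /g indicE mem_set//; under [X in _ --> limn X]eq_fun do rewrite mulr1.
    exact: cS.
  have SgB : S N x - S n x @[N --> \oo] --> g x - S n x.
    by apply: (cvgB Sg); exact: cvg_cst.
  have SgK : ((S N x - S n x) ^+ K)%:E @[N --> \oo] --> ((g x - S n x) ^+ K)%:E.
    apply: cvg_EFin; first exact: nearW.
    have := @exprn_continuous R K (g x - S n x).
    move=> /(continuous_cvg _)/(_ SgB); exact.
  rewrite -(cvg_lim _ SgK)//; apply: lime_le; first by apply/cvg_ex; eexists; exact: SgK.
  exists n => // N /= nN; apply: le_trans (L_ge n x (N - n)%N).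
  rewrite lee_fin -[leLHS]ger0_norm// normrX lerXn2r ?nnegrE//.
  have -> : S N x - S n x = \sum_(n <= i < N) Lspace_repr (v i) x.
    by rewrite /S (big_cat_nat (n:=n) (p:=N))//= addrAC subrr add0r.
  apply: le_trans (ler_norm_sum _ _ _) _; rewrite /sum_abs -{1}[n]add0n big_addn.
  by apply: ler_sum => i _; rewrite addnC.
have [|l lE] := Lspace_mk mg.
  apply: le_lt_trans (ltry ((2 * 2^-1 ^+ 0) ^+ K)).
  apply: le_trans (gS 0); rewrite le_eqVlt; apply/orP; left; apply/eqP.
  by apply: eq_integral => x _; rewrite /S big_geq// subr0.
have uE n : u n - u 0 = \sum_(0 <= i < n) v i by rewrite telescope_sumr.
have lu n : `|l - (u n - u 0)| <= 2 * 2^-1 ^+ n.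
  rewrite -Lspace_norm_le ?mulr_ge0 ?exprn_ge0// -lee_fin; apply: le_trans (gS n).
  rewrite (@Lspace_norm_ae _ (fun x => g x - S n x))//; first exact: measurable_funB.
  rewrite uE; apply: (filterS3 _ _ (Lspace_reprB l (\sum_(0 <= i < n) v i)) lE
    (Lspace_repr_sum v n)) => x h1 h2 h3 _.
  by rewrite h1// h2// h3.
apply/cvg_ex; exists (l + u 0); apply/cvgrPdist_lt => e e0.
have [n ne] := half_expr_small e0.
exists n => // k /= nk.
have -> : l + u 0 - u k = l - (u k - u 0) by rewrite opprB addrA.
apply: le_lt_trans (lu k) (le_lt_trans _ ne).
by rewrite ler_wpM2l// ler_wiXn2l ?invf_le1 ?ler1n.
Qed.

End even_Lspace.

(** * Density of simple functions *)

Section even_Lspace_total.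
Context d (T : measurableType d) (R : realType) (mu : {measure set T -> \bar R}).
Variable m : nat.
Local Notation K := (2 * m.+1)%N.
Local Notation V := (LspaceType mu (le1_even_exponent R m)).
Local Notation "f ~~ g" := ((f : T -> R) = g %[ae mu]) (at level 70).
Implicit Types f g h : V.
Import HBSimple HBNNSimple.

Let Kge0 (x : R) : 0 <= x ^+ K.
Proof. exact: even_expr_ge0. Qed.

Lemma integral_indic_expr (A : set T) : measurable A ->
  (\int[mu]_x ((\1_A x : R) ^+ K)%:E)%E = mu A.
Proof.
move=> mA; rewrite -[in RHS](setIT A) -integral_indic//.
by apply: eq_integral => x _; rewrite indicE; case: (_ \in _); rewrite ?expr1n// expr0n.
Qed.

Lemma Lspace_indic (A : set T) : measurable A -> (mu A < +oo)%E ->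
  exists f : V, Lspace_repr f ~~ \1_A.
Proof.
by move=> mA Aoo; apply: Lspace_mk; [exact: measurable_indic|rewrite integral_indic_expr].
Qed.

(** Both sides integrate the indicator of the symmetric difference, since the
    exponent is even. *)
Lemma Lspace_indic_dist f g (A U : set T) : measurable A -> measurable U ->
  Lspace_repr f ~~ \1_A -> Lspace_repr g ~~ \1_U ->
  ((`|f - g| ^+ K)%:E = mu ((A `\` U) `|` (U `\` A)))%E.
Proof.
move=> mA mU fA gU.
have mAU : measurable_fun [set: T] (fun x => \1_A x - \1_U x : R).
  by apply: measurable_funB; exact: measurable_indic.
rewrite (Lspace_norm_ae mAU).
  rewrite -integral_indic_expr; last by apply: measurableU; exact: measurableD.
  apply: eq_integral => x _; congr (_%:E).
  rewrite !indicE.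
  have [Ax|Ax] := pselect (A x); have [Ux|Ux] := pselect (U x);
    rewrite ?(mem_set Ax) ?(mem_set Ux) ?(memNset Ax) ?(memNset Ux).
  - by rewrite memNset ?subrr// => -[[]|[]].
  - by rewrite mem_set ?subr0//; left.
  - by rewrite mem_set ?sub0r ?exprM ?sqrrN//; right.
  - by rewrite memNset ?subrr// => -[[]|[]].
by apply: (filterS3 _ _ (Lspace_reprB f g) fA gU) => x h1 h2 h3 _;
  rewrite h1// h2// h3.
Qed.

Section closed_subspace.
Variable M : set V.
Hypothesis cM : closed M.
Hypothesis M0 : M 0.
Hypothesis MP : forall a f g, M f -> M g -> M (a *: f + g).
Hypothesis M_indic : forall (A : set T) f, measurable A -> (mu A < +oo)%E ->
  Lspace_repr f ~~ \1_A -> M f.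

Lemma closed_subspace_step (s : seq (R * set T)) :
  (forall p, p \in s -> measurable p.2 /\ (mu p.2 < +oo)%E) ->
  exists2 f, M f & Lspace_repr f ~~ (fun x => \sum_(p <- s) p.1 * \1_(p.2) x).
Proof.
elim: s => [_|p s IH H].
  by exists 0 => //; apply: filterS (@Lspace_repr0 _ _ _ mu m) => x h _;
    rewrite h// big_nil.
have [|f Mf fE] := IH; first by move=> q qs; apply: H; rewrite in_cons qs orbT.
have [mp poo] := H p (mem_head _ _).
have [g gE] := Lspace_indic mp poo.
exists (p.1 *: g + f); first by apply: MP => //; exact: M_indic gE.
have h4 := Lspace_reprZ p.1 g.
apply: (filterS3 _ _ (Lspace_reprD (p.1 *: g) f) fE (filterI gE h4)).
by move=> x h1 h2 [h3 h5] _; rewrite h1// h2// h5// h3// big_cons.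
Qed.

(** The level sets of nonzero value have finite measure by Chebyshev's inequality;
    the value 0 has to be left out, as its level set may have infinite measure. *)
Lemma closed_subspace_nnsfun (g : {nnsfun T >-> R}) :
  (\int[mu]_x (g x ^+ K)%:E < +oo)%E ->
  exists2 f, M f & Lspace_repr f ~~ g.
Proof.
move=> goo.
pose s := [seq (y, g @^-1` [set y]) | y <- finmap.enum_fset (fset_set (range g)) & y != 0].
have [p /mapP[y]|f Mf fE] := @closed_subspace_step s.
  rewrite mem_filter => /andP[y0 _] -> /=.
  have mA : measurable (g @^-1` [set y]).
    by rewrite -[X in measurable X]setTI; exact: measurable_funP.
  split=> //; rewrite -integral_indic_expr//.
  have yK : 0 < y ^+ K by rewrite exprM exprn_gt0// exprn_even_gt0.
  have : (\int[mu]_x ((y ^- K)%:E * (g x ^+ K)%:E) < +oo)%E.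
    rewrite ge0_integralZl//.
    - by rewrite lte_mul_pinfty// lee_fin invr_ge0 ltW.
    - by apply: measurable_EFin_expr; exact: measurable_funP.
    - by move=> x _; rewrite lee_fin.
    - by rewrite lee_fin invr_ge0 ltW.
  apply: le_lt_trans; apply: ge0_le_integral => //.
  - by apply: measurable_EFin_expr; exact: measurable_indic.
  - apply/measurable_EFinP; apply: measurable_funM => //.
    by apply: measurable_funX; exact: measurable_funP.
  - move=> x _; rewrite -EFinM lee_fin indicE.
    have [xA|xA] := pselect ((g @^-1` [set y]) x).
      by rewrite mem_set// expr1n xA mulVf// gt_eqF.
    by rewrite memNset// expr0n mulr_ge0// invr_ge0 ltW.
exists f => //; apply: filterS fE => x h _; rewrite h//.
rewrite fimfunE fsbig_finite//= big_map big_filter [RHS](bigID (fun y => y != 0))/=.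
rewrite [X in _ = _ + X]big1 ?addr0// => y /negPn/eqP ->.
by rewrite mul0r.
Qed.

(** Simple functions increasing to u converge to u in norm by dominated
    convergence, with u^K as the dominating function. *)
Lemma closed_subspace_ge0 f (u : T -> R) : measurable_fun [set: T] u ->
  (forall x, 0 <= u x) -> Lspace_repr f ~~ u -> M f.
Proof.
move=> mu_ u0 fu.
have uoo : (\int[mu]_x (u x ^+ K)%:E < +oo)%E by rewrite -(Lspace_norm_ae mu_ fu) ltry.
have mEu : measurable_fun [set: T] (EFin \o u) by exact/measurable_EFinP.
have [x _|g [gnd gu]] := approximation measurableT mEu; first by rewrite lee_fin.
have cgu x : g n x @[n --> \oo] --> u x.
  exact: (fine_cvg (gu x I)).
have gle n x : g n x <= u x.
  rewrite -(cvg_lim _ (cgu x))//; apply: nondecreasing_cvgn_le.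
    by move=> i j ij; have /lefP := gnd _ _ ij; exact.
  by apply/cvg_ex; exists (u x); exact: cgu.
have mg n : measurable_fun [set: T] (g n) by exact: measurable_funP.
have hK n x : (u x - g n x) ^+ K <= u x ^+ K.
  by rewrite lerXn2r ?nnegrE ?subr_ge0// gerBl.
have iu : mu.-integrable [set: T] (fun x => (u x ^+ K)%:E).
  apply/integrableP; split; first exact: measurable_EFin_expr.
  by under eq_integral do rewrite gee0_abs ?lee_fin//.
have lim0 : (\int[mu]_x ((u x - g n x) ^+ K)%:E)%E @[n --> \oo] --> 0%E.
  have cv : \forall x \ae mu, [set: T] x ->
      ((u x - g n x) ^+ K)%:E @[n --> \oo] --> 0%E.
    apply: nearW => x _; apply: cvg_EFin; first exact: nearW.
    have /(continuous_cvg _) : {for u x - u x, continuous (fun y : R => y ^+ K)}.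
      exact: exprn_continuous.
    rewrite subrr expr0n/= => /(_ _ _ _ (fun n => u x - g n x)); apply.
    by rewrite -[X in _ --> X](subrr (u x)); apply: cvgB => //; exact: cvg_cst.
  have bd : \forall x \ae mu, forall n, [set: T] x ->
      (`|((u x - g n x) ^+ K)%:E| <= (u x ^+ K)%:E)%E.
    by apply: nearW => x n _; rewrite gee0_abs ?lee_fin.
  have [_ _] := dominated_convergence measurableT
    (fun n => measurable_EFin_expr (measurable_funB mu_ (mg n)))
    (measurable_cst _) cv iu bd.
  by rewrite integral0.
have H : forall n, exists2 h : V, M h &
    ((`|f - h| ^+ K)%:E = \int[mu]_x ((u x - g n x) ^+ K)%:E)%E.
  move=> n; have [|h Mh hg] := @closed_subspace_nnsfun (g n).
    apply: le_lt_trans uoo; apply: ge0_le_integral => //.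
    - by move=> x _; rewrite lee_fin.
    - exact: measurable_EFin_expr.
    - exact: measurable_EFin_expr.
    - by move=> x _; rewrite lee_fin lerXn2r ?nnegrE.
  exists h => //; apply: Lspace_norm_ae; first exact: measurable_funB.
  by apply: (filterS3 _ _ (Lspace_reprB f h) fu hg) => x h1 h2 h3 _;
    rewrite h1// h2// h3.
apply: cM => A /nbhs_ballP[e /= e0 eA].
have eK : (0 < (e ^+ K)%:E)%E by rewrite lte_fin exprn_gt0.
have small : \forall n \near \oo,
    (\int[mu]_x ((u x - g n x) ^+ K)%:E < (e ^+ K)%:E)%E.
  exact: lim0 _ (open_ereal_lt' eK).
have [n nE] := @filter_ex _ _ _ _ small.
have [h Mh hE] := H n; exists h; split => //; apply: eA.
rewrite -ball_normE/=; move: nE; rewrite -hE lte_fin.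
by rewrite ltr_pXn2r ?nnegrE ?(ltW e0).
Qed.

Lemma closed_subspace_full f : M f.
Proof.
pose u x : R := Num.max (Lspace_repr f x) 0.
pose v x : R := Num.max (- Lspace_repr f x) 0.
have mf : measurable_fun [set: T] (Lspace_repr f : T -> R) by exact: Lspace_measurable.
have mu_ : measurable_fun [set: T] u by apply: measurable_maxr.
have mv : measurable_fun [set: T] v.
  by apply: measurable_maxr => //; exact: measurableT_comp.
have uv x : Lspace_repr f x = u x - v x.
  by rewrite /u /v; case: (leP 0 (Lspace_repr f x)) => h;
    case: (leP (- Lspace_repr f x) 0) => h'; rewrite ?subr0 ?sub0r ?opprK//; lra.
have fin (w : T -> R) : measurable_fun [set: T] w ->
    (forall x, 0 <= w x <= `|Lspace_repr f x|) ->
    exists h : V, Lspace_repr h ~~ w.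
  move=> mw wf; apply: Lspace_mk => //; apply: le_lt_trans (Lspace_integral_lty f).
  apply: ge0_le_integral => //.
  - by move=> x _; rewrite lee_fin.
  - exact: measurable_EFin_expr.
  - exact: measurable_EFin_expr.
  - move=> x _; have /andP[w0 wx] := wf x.
    rewrite lee_fin -[leRHS]ger0_norm// normrX lerXn2r ?nnegrE//.
have [x|fu fuE] := fin u mu_.
  by rewrite /u le_max lexx orbT ge_max ler_norm normr_ge0.
have [x|fv fvE] := fin v mv.
  by rewrite /v le_max lexx orbT ge_max -normrN ler_norm normr_ge0.
have -> : f = (-1) *: fv + fu.
  apply: Lspace_eqP; rewrite scaleN1r addrC.
  by apply: (filterS3 _ _ (Lspace_reprB fu fv) fuE fvE) => x h1 h2 h3 _;
    rewrite h1// h2// h3.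
apply: MP; [apply: closed_subspace_ge0 fvE|apply: closed_subspace_ge0 fuE] => // x.
  by rewrite /v le_max lexx orbT.
by rewrite /u le_max lexx orbT.
Qed.

End closed_subspace.

(** A closed subspace that contains the indicators of the sets in B contains those
    of all sets of finite measure by approximation, hence all simple functions,
    hence everything. *)
Lemma Lspace_countably_total (B : set (set T)) : countable B ->
  (forall U, B U -> measurable U /\ (mu U < +oo)%E) ->
  (forall A (e : R), measurable A -> (mu A < +oo)%E -> 0 < e ->
    exists2 U, B U & (mu ((A `\` U) `|` (U `\` A)) < e%:E)%E) ->
  countably_total V.
Proof.
move=> cB mB appB.
exists [set f : V | exists2 U, B U & Lspace_repr f ~~ \1_U].
  apply: (@sub_countable _ _ _ [set xget 0 [set f : V | Lspace_repr f ~~ \1_U] | U in B]).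
    apply: subset_card_le => f [U BU fU]; exists U => //.
    case: xgetP => [g _ gU|/(_ f)//].
    by apply: Lspace_eqP; apply: filterS2 fU gU => x h1 h2 _; rewrite h1// h2.
  exact: card_le_trans (card_image_le _ _) cB.
move=> M cM M0 MP SM; apply: closed_subspace_full => // A f mA Aoo fA.
apply: cM => W /nbhs_ballP[e /= e0 eW].
have [U BU AU] := appB A (e ^+ K) mA Aoo (exprn_gt0 K e0).
have [mU Uoo] := mB _ BU; have [g gU] := Lspace_indic mU Uoo.
exists g; split; first by apply: SM; exists U.
apply: eW; rewrite -ball_normE/=; move: AU.
rewrite -(Lspace_indic_dist mA mU fA gU) lte_fin.
by rewrite ltr_pXn2r ?nnegrE ?(ltW e0).
Qed.

End even_Lspace_total.
(** * Composition with a measure preserving map *)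

Section measure_preserving_composition.
Context d (T : measurableType d) (R : realType) (mu : {measure set T -> \bar R}).

Definition measure_preserving (phi : T -> T) :=
  measurable_fun [set: T] phi /\
  forall A, measurable A -> mu (phi @^-1` A) = mu A.

Lemma measure_preserving_integral phi (u : T -> \bar R) : measure_preserving phi ->
  measurable_fun [set: T] u -> (forall x, 0 <= u x)%E ->
  (\int[mu]_x u (phi x) = \int[mu]_x u x)%E.
Proof.
move=> [mphi phiE] mu_ u0.
have := ge0_integral_pushforward mphi mu measurableT mu_ (fun y _ => u0 y).
rewrite preimage_setT => <-.
by apply: eq_measure_integral => A mA _; exact: phiE.
Qed.

Lemma measure_preserving_ae phi (P : T -> Prop) : measure_preserving phi ->
  {ae mu, forall x, P x} -> {ae mu, forall x, P (phi x)}.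
Proof.
move=> [mphi phiE] [A [mA A0 PA]].
exists (phi @^-1` A); split.
- by rewrite -[X in measurable X]setTI; exact: mphi.
- by rewrite phiE.
- by move=> x /= Px; exact: PA.
Qed.

Variable m : nat.
Local Notation K := (2 * m.+1)%N.
Local Notation V := (LspaceType mu (le1_even_exponent R m)).
Local Notation "f ~~ g" := ((f : T -> R) = g %[ae mu]) (at level 70).
Implicit Types f g h : V.

Let Kge0 (x : R) : 0 <= x ^+ K.
Proof. exact: even_expr_ge0. Qed.

Lemma Lspace_comp_subproof phi f : exists h : V, measure_preserving phi ->
  Lspace_repr h ~~ (fun x => Lspace_repr f (phi x)).
Proof.
have [mp|nmp] := pselect (measure_preserving phi); last by exists 0 => /nmp.
have mf : measurable_fun [set: T] (fun x => Lspace_repr f (phi x) : R).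
  by apply: measurableT_comp; [exact: Lspace_measurable|exact: mp.1].
have [|h hE] := @Lspace_mk _ _ _ mu m _ mf; last by exists h.
rewrite (measure_preserving_integral (u := fun x => (Lspace_repr f x ^+ K)%:E))//.
- exact: Lspace_integral_lty.
- by apply/measurable_EFinP; apply: measurable_funX; exact: Lspace_measurable.
- by move=> x; rewrite lee_fin.
Qed.

(** Composition takes a default value for maps that do not preserve the measure: it
    need not be well defined on classes then. *)
Definition Lspace_comp phi f : V := sval (cid (Lspace_comp_subproof phi f)).

Lemma Lspace_comp_ae phi f (u : T -> R) : measure_preserving phi ->
  Lspace_repr f ~~ u -> Lspace_repr (Lspace_comp phi f) ~~ (fun x => u (phi x)).
Proof.
move=> mp fu; have := svalP (cid (Lspace_comp_subproof phi f)) mp.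
have fu' : {ae mu, forall x, Lspace_repr f x = u x} by apply: filterS fu => x; exact.
have := measure_preserving_ae mp fu'.
by apply: filterS2 => x h1 h2 _; rewrite -/(Lspace_comp phi f) in h2; rewrite h2// h1.
Qed.

Lemma Lspace_compP phi a f g : measure_preserving phi ->
  Lspace_comp phi (a *: f + g) = a *: Lspace_comp phi f + Lspace_comp phi g.
Proof.
move=> mp; apply: Lspace_eqP.
have e1 := Lspace_comp_ae mp (Lspace_reprD (a *: f) g).
have e2 := measure_preserving_ae mp (Lspace_reprZ a f).
have e3 := Lspace_comp_ae mp (ae_eq_refl _ _ (Lspace_repr f : T -> R)).
have e4 := Lspace_comp_ae mp (ae_eq_refl _ _ (Lspace_repr g : T -> R)).
have e5 := Lspace_reprD (a *: Lspace_comp phi f) (Lspace_comp phi g).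
have e6 := Lspace_reprZ a (Lspace_comp phi f).
apply: (filterS3 _ _ (filterI e1 e2) (filterI e3 e4) (filterI e5 e6)).
by move=> x [h1 h2] [h3 h4] [h5 h6] _; rewrite h1// h2// h5// h6// h3// h4.
Qed.

Lemma Lspace_comp_norm phi f : measure_preserving phi ->
  `|Lspace_comp phi f| = `|f|.
Proof.
move=> mp; apply/eqP; rewrite -(eqrXn2 (n:=K))//; apply/eqP/EFin_inj.
have mf := Lspace_measurable f.
have := Lspace_comp_ae mp (ae_eq_refl _ _ (Lspace_repr f : T -> R)).
move=> /Lspace_norm_ae ->; last by apply: measurableT_comp => //; exact: mp.1.
rewrite (Lspace_norm_ae mf (ae_eq_refl _ _ _)).
apply: (measure_preserving_integral (u := fun x => (Lspace_repr f x ^+ K)%:E)) => //.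
  by apply/measurable_EFinP; exact: measurable_funX.
by move=> x; rewrite lee_fin.
Qed.

Lemma Lspace_comp_comp phi psi f :
  measure_preserving phi -> measure_preserving psi ->
  Lspace_comp phi (Lspace_comp psi f) = Lspace_comp (psi \o phi) f.
Proof.
move=> mphi mpsi; apply: Lspace_eqP.
have mpp : measure_preserving (psi \o phi).
  split=> [|A mA]; first exact: measurableT_comp mpsi.1 mphi.1.
  rewrite comp_preimage mphi.2 ?mpsi.2//.
  by rewrite -[X in measurable X]setTI; exact: mpsi.1.
have e0 := ae_eq_refl mu setT (Lspace_repr f : T -> R).
have e1 := Lspace_comp_ae mphi (Lspace_comp_ae mpsi e0).
have e2 := Lspace_comp_ae mpp e0.
by apply: filterS2 e1 e2 => x h1 h2 _; rewrite h1// h2.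
Qed.

Lemma Lspace_comp_id f : Lspace_comp id f = f.
Proof.
apply: Lspace_eqP; apply: (Lspace_comp_ae _ (ae_eq_refl _ _ _)).
by split=> //; exact: measurable_id.
Qed.

End measure_preserving_composition.
(** * Affine actions from cocycles *)

Section isometric_affine_action.
Context (R : realType) (G : topologicalGroupType) (X : normedModType R).

Lemma isometry_continuous (C : {linear X -> X}) :
  (forall x, `|C x| = `|x|) -> continuous C.
Proof.
move=> nC; apply/linear_bounded_continuous/linear_boundedP.
near=> r => x; rewrite nC -[leLHS]mul1r; apply: ler_wpM2r => //.
Unshelve. all: by end_near. Qed.

Lemma isometry_GL (A B : {linear X -> X}) :
  (forall x, `|A x| = `|x|) -> (forall x, `|B x| = `|x|) ->
  cancel A B -> cancel B A -> GL A.
Proof.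
move=> nA nB AB BA; split; first exact: isometry_continuous.
by exists B; split=> //; exact: isometry_continuous.
Qed.

Variables (pi : G -> {linear X -> X}) (b : G -> X).
Hypothesis pi_norm : forall g x, `|pi g x| = `|x|.
Hypothesis pi1 : forall x, pi 1%g x = x.
Hypothesis piM : forall g h x, pi (g * h)%g x = pi g (pi h x).
Hypothesis bM : forall g h, b (g * h)%g = pi g (b h) + b g.

(** For an isometric linear part, |act g xi| >= |b g| - |xi|, so properness only
    concerns the orbit of 0. *)
Lemma isometric_action_of_cocycle : exists alpha : affine_action G X,
  isometric_action alpha /\
  ((forall C : R, exists2 K : set G, compact K & forall g, ~ K g -> C <= `|b g|) ->
  proper_action alpha).
Proof.
have piGL g : GL (pi g).
  apply: (@isometry_GL _ (pi g^-1%g)) => //= x.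
    by rewrite -piM mulVg pi1.
  by rewrite -piM mulgV pi1.
have aM g h : (fun xi => pi (g * h)%g xi + b (g * h)%g) =
    (fun xi => pi g xi + b g) \o (fun xi => pi h xi + b h).
  by apply/funext => xi /=; rewrite piM bM linearD addrA.
exists (@AffineAction R G X pi b piGL aM); split=> // bC xi C C0.
have [K cK KP] := bC (C + `|xi|); exists K => // g /KP bg.
rewrite /act/=; have := lerB_normD (b g) (pi g xi).
by rewrite pi_norm [pi g xi + _]addrC; apply: le_trans; lra.
Qed.

End isometric_affine_action.

Section l2sum_map.
Context (R : realType) (V : nat -> normedModType R).
Variable S : forall n, V n -> V n.
Hypothesis S_norm : forall n v, `|S (n:=n) v| = `|v|.
Hypothesis S_linear : forall n a v w, S (n:=n) (a *: v + w) = a *: S v + S w.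

Lemma l2sum_map_subproof (x : l2sum V) :
  exists2 y : l2sum V, (forall n, y n = S (x n)) & `|y| ^+ 2 <= `|x| ^+ 2.
Proof.
apply: l2sum_mk => N; under eq_bigr do rewrite S_norm; exact: l2sum_partial_le.
Qed.

Definition l2sum_map x := s2val (cid2 (l2sum_map_subproof x)).

Lemma l2sum_mapE x n : l2sum_map x n = S (x n).
Proof. exact: (s2valP (cid2 (l2sum_map_subproof x))). Qed.

Lemma l2sum_map_linear : linear l2sum_map.
Proof.
by move=> a x y; apply: l2sum_ext => n /=; rewrite !l2sum_mapE S_linear.
Qed.

Lemma l2sum_map_norm x : `|l2sum_map x| = `|x|.
Proof.
apply/eqP; rewrite eq_le -(ler_pXn2r (n:=2)) ?nnegrE//.
rewrite -[X in _ && X](ler_pXn2r (n:=2)) ?nnegrE//.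
rewrite (s2valP' (cid2 (l2sum_map_subproof x)))/=.
apply: l2sum_sqr_norm_le => N; apply: le_trans (l2sum_partial_le (l2sum_map x) N).
by apply: ler_sum => n _; rewrite l2sum_mapE S_norm.
Qed.

End l2sum_map.

(** * Exhaustion of a locally compact group *)

Section topological_group.
Context (G : topologicalGroupType).
Implicit Types (A B : set G).

Lemma compact_mulg A B : compact A -> compact B ->
  compact [set (x * y)%g | x in A & y in B].
Proof.
move=> cA cB.
have -> : [set (x * y)%g | x in A & y in B] =
    [set (p.1 * p.2)%g | p in A `*` B].
  apply/seteqP; split=> [_ [x Ax [y By <-]]|_ [[x y] [/= Ax By] <-]].
    by exists (x, y).
  by exists x => //; exists y.
apply: continuous_compact; last exact: compact_setX.
by apply: continuous_subspaceT; exact: mulg_continuous.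
Qed.

Lemma compact_invg A : compact A -> compact [set (x^-1)%g | x in A].
Proof.
move=> cA; apply: continuous_compact => //.
by apply: continuous_subspaceT; exact: invg_continuous.
Qed.

(** Every point has a compact neighbourhood, which contains a member of the
    countable base around that point; one compact set is chosen for each member of
    the base that is contained in some compact set. *)
Lemma sigma_compact : locally_compact [set: G] -> @second_countable G ->
  exists2 C : nat -> set G, (forall n, compact (C n)) & forall x, exists n, C n x.
Proof.
move=> lc [B /countable_injP[f finj] [Bo BP]].
pose P n K := compact K /\ exists2 U, B U & f U = n /\ U `<=` K.
pose C n := xget set0 (P n).
exists C => [n|x].
  by rewrite /C; case: xgetP => [K _ []//|_]; exact: compact0.
have [W xW cW] : exists2 W, nbhs x W & compact W.
  by have [W xW [cW _]] := lc x I; exists W => //; move: xW; rewrite /within/=; apply: filterS => y; exact.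
have [U [BU Ux] UW] := BP x _ xW.
exists (f U); rewrite /C.
have PU : P (f U) W by split=> //; exists U.
case: xgetP => [K _ [_ [U' BU' [fU' U'K]]]|/(_ W)//].
by apply: U'K; have -> : U' = U by apply: finj; rewrite ?inE.
Qed.

Definition symmetric_hull A : set G := A `|` [set (x^-1)%g | x in A] `|` [set 1%g].

Fixpoint exhaustion (C0 : set G) (C : nat -> set G) n : set G :=
  if n is n'.+1 then [set (x * y)%g | x in exhaustion C0 C n' & y in exhaustion C0 C n']
     `|` symmetric_hull (C n')
  else symmetric_hull C0.

(** A substitute for a proper left-invariant metric: the least n with V n x behaves
    like the logarithm of a length. *)
Record doubling_exhaustion (V : nat -> set G) : Prop := DoublingExhaustion {
  exhaustion_compact : forall n, compact (V n) ;
  exhaustion1 : forall n, V n 1%g ;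
  exhaustionV : forall n x, V n x -> V n (x^-1)%g ;
  exhaustionM : forall n x y, V n x -> V n y -> V n.+1 (x * y)%g ;
  exhaustion_full : forall x, exists n, V n x }.

Lemma symmetric_hullV A x : symmetric_hull A x -> symmetric_hull A (x^-1)%g.
Proof.
move=> [[Ax|[y Ay <-]]|->]; last by right; rewrite /= invg1.
- by left; right; exists x.
- by left; left; rewrite invgK.
Qed.

Lemma symmetric_hull_compact A : compact A -> compact (symmetric_hull A).
Proof.
move=> cA; apply: compactU; last exact: compact_set1.
by apply: compactU => //; exact: compact_invg.
Qed.

Lemma exhaustionP C0 C : compact C0 -> (forall n, compact (C n)) ->
  (forall x, exists n, C n x) -> doubling_exhaustion (exhaustion C0 C).
Proof.
move=> cC0 cC CT; split.
- elim=> [|n IH] /=; first exact: symmetric_hull_compact.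
  by apply: compactU; [exact: compact_mulg|exact: symmetric_hull_compact].
- by case=> [|n] /=; [right|right; right].
- elim=> [|n IH] x /=; first exact: symmetric_hullV.
  move=> [[y Vy [z Vz <-]]|Cx]; last by right; exact: symmetric_hullV.
  by left; rewrite invgM; exists (z^-1)%g; [exact: IH|exists (y^-1)%g; [exact: IH|]].
- by move=> n x y Vx Vy /=; left; exists x => //; exists y.
- by move=> x; have [n Cn] := CT x; exists n.+1 => /=; right; left; left.
Qed.

Lemma exhaustion_le V n k : doubling_exhaustion V -> (n <= k)%N -> V n `<=` V k.
Proof.
move=> VE nk x Vx; rewrite -(subnKC nk); elim: (k - n)%N => [|i IH].
  by rewrite addn0.
by rewrite addnS -[x]mulg1; apply: (exhaustionM VE) => //; exact: exhaustion1.
Qed.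

End topological_group.
(** * Left Haar measures *)

Section haar_measure.
Context (R : realType) (G : topologicalGroupType)
  (mu : {measure set (borelType G) -> \bar R}).
Hypothesis G_hausdorff : hausdorff_space G.
Hypothesis mu_haar : left_haar mu.

Lemma open_borel (U : set G) : open U -> measurable (U : set (borelType G)).
Proof. exact: sub_sigma_algebra. Qed.

Lemma compact_borel (A : set G) : compact A -> measurable (A : set (borelType G)).
Proof.
move=> cA; rewrite -[X in measurable X]setCK; apply: measurableC.
by apply: open_borel; apply: closed_openC; exact: compact_closed.
Qed.

Definition translation (g : G) : borelType G -> borelType G :=
  fun x => (g^-1 * (x : G))%g.

Lemma translation_measure_preserving g : measure_preserving mu (translation g).
Proof.
have mt h : measurable_fun [set: borelType G] (translation h).
  apply: (@measurability _ _ (borelType G) (borelType G) _ _ (@open G) erefl).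
  move=> _ [U oU <-]; rewrite setTI.
  apply: open_borel; apply: open_comp => // x _.
  have : continuous (fun x : G => (h^-1, x)%g : G * G).
    by move=> y; apply: cvg_pair => //=; exact: cvg_cst.
  move=> hc.
  apply: (@continuous_comp _ _ _ (fun y : G => (h^-1, y)%g)
    (fun p : G * G => (p.1 * p.2)%g)); [exact: hc|exact: mulg_continuous].
split=> // A mA; rewrite -[RHS](left_haar_invariant mu_haar g mA); congr (mu _).
apply/seteqP; split=> [x /= Ax|_ [x Ax <-]].
  by exists (translation g x) => //; rewrite /translation mulgA mulgV mul1g.
by rewrite /preimage/translation/= mulgA mulVg mul1g.
Qed.

(** The sets are the finite unions of members of a countable base. By outer
    regularity A is approximated by an open set U containing it, and U is an
    increasing union of such finite unions. *)
Lemma left_haar_countable_approx : @second_countable G ->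
  exists2 B : set (set (borelType G)), countable B &
  (forall U, B U -> measurable U /\ (mu U < +oo)%E) /\
  (forall A (e : R), measurable A -> (mu A < +oo)%E -> 0 < e ->
    exists2 U, B U & (mu ((A `\` U) `|` (U `\` A)) < e%:E)%E).
Proof.
move=> [B /countable_injP[f finj] [Bo BP]].
pose b n : set G := xget set0 [set U | B U /\ f U = n].
have bo n : open (b n).
  by rewrite /b; case: xgetP => [U _ [/Bo]//|_]; exact: open0.
have bB U : B U -> exists n, b n = U.
  move=> BU; exists (f U); rewrite /b; case: xgetP => [W _ [BW WU]|/(_ U)[//]].
  by apply: finj => //; rewrite inE.
pose un (s : seq nat) : set (borelType G) := \big[setU/set0]_(i <- s) b i.
have unP s x : un s x <-> exists2 i, i \in s & b i x.
  by rewrite /un -bigcup_seq.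
have mun s : measurable (un s).
  by apply: bigsetU_measurable => i _; exact: open_borel.
exists [set U | (exists s, un s = U) /\ (mu U < +oo)%E].
  apply: (@sub_countable _ _ _ (range un)).
    by apply: subset_card_le => U [[s <-] _]; exists s.
  exact: (card_le_trans (card_image_le _ _) (countableP _)).
split=> [U [[s <-] ?]//|A e mA Aoo e0].
have e20 : 0 < e / 2 by rewrite divr_gt0.
have Afin : mu A \is a fin_num by rewrite ge0_fin_numE.
have [_ [U [oU AU] <-] UA] :
    exists2 y, [set mu U | U in [set U : set G | open U /\ A `<=` U]] y &
      (y < mu A + (e / 2)%:E)%E.
  have outer := left_haar_outer mu_haar mA; rewrite outer in Afin *.
  exact: lb_ereal_inf_adherent.
have mU := open_borel oU.
have Uoo : (mu U < +oo)%E by apply: lt_le_trans UA _; rewrite leey.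
pose W n := un [seq i <- iota 0 n | `[< b i `<=` U >]].
have WU n : W n `<=` U.
  by move=> x /unP[i]; rewrite mem_filter => /andP[/asboolP h _] /h.
have UW : \bigcup_n W n = U.
  apply/seteqP; split=> [x [n _ /WU]//|x Ux].
  have [Z [BZ Zx] ZU] := BP x _ (open_nbhs_nbhs (conj oU Ux)).
  have [n nZ] := bB Z BZ; exists n.+1 => //; apply/unP; exists n; last by rewrite nZ.
  by rewrite mem_filter mem_iota add0n ltnSn !andbT; apply/asboolP; rewrite nZ.
have Wnd : {homo W : n k / (n <= k)%N >-> (n <= k)%O}.
  move=> n k nk; apply/subsetPset => x /unP[i ib bi]; apply/unP; exists i => //.
  move: ib; rewrite !mem_filter !mem_iota !add0n => /andP[-> /=] /leq_trans; exact.
have fin (Z : set (borelType G)) : measurable Z -> Z `<=` U -> exists r, mu Z = r%:E.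
  move=> mZ ZU; exists (fine (mu Z)); rewrite fineK// ge0_fin_numE//.
  by apply: le_lt_trans Uoo; apply: le_measure; rewrite ?inE.
have [u uE] := fin U mU (@subset_refl _ U).
have [a aE] := fin A mA AU.
have [n Wn] : exists n, ((u - e / 2)%:E < mu (W n))%E.
  have := @nondecreasing_cvg_mu _ _ _ mu W (fun n => mun _).
  rewrite UW => /(_ mU Wnd) cW.
  have small : \forall n \near \oo, ((u - e / 2)%:E < mu (W n))%E.
    have uU : ((u - e / 2)%:E < mu U)%E by rewrite uE lte_fin ltrBlDr ltrDl.
    exact: (cW _ (open_ereal_gt' uU)).
  exact: (@filter_ex _ _ _ _ small).
have [w wE] := fin (W n) (mun _) (WU n).
exists (W n); first by split; [eexists|rewrite wE ltry].
have -> : e%:E = ((e / 2)%:E + (e / 2)%:E)%E by rewrite -EFinD -splitr.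
have UWn : (mu (U `\` W n) < (e / 2)%:E)%E.
  rewrite measureD//; last exact: mun.
  rewrite setIidr// [X in (X - _)%E]uE [X in (_ - X)%E]wE -EFinB lte_fin.
  by move: Wn; rewrite wE lte_fin; lra.
have UAn : (mu (U `\` A) < (e / 2)%:E)%E.
  rewrite measureD// setIidr// [X in (X - _)%E]uE [X in (_ - X)%E]aE -EFinB lte_fin.
  by move: UA; rewrite uE aE -EFinD lte_fin; lra.
have mAW : measurable (A `\` W n) by apply: measurableD => //; exact: mun.
have mWA : measurable (W n `\` A) by apply: measurableD => //; exact: mun.
apply: (@le_lt_trans _ _ (mu (A `\` W n) + mu (W n `\` A))%E); first exact: measureU2.
apply: lteD.
- apply: le_lt_trans UWn; apply: le_measure; rewrite ?inE//.
    by apply: measurableD => //; exact: mun.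
  exact: setSD.
- apply: le_lt_trans UAn; apply: le_measure; rewrite ?inE//.
    exact: measurableD.
  by apply: setSD; exact: WU.
Qed.

End haar_measure.
(** * Slowly varying functions on the group *)

Section plateau.
Context (R : realType) (G : topologicalGroupType) (V : nat -> set G).
Hypothesis VE : doubling_exhaustion V.

Definition plateau (k : nat) (x : borelType G) : R :=
  2^-1 ^+ k * \sum_(0 <= i < 2 ^ k) \1_(V (k + i)) x.

Lemma indic_le (T S : Type) (A : set T) (B : set S) (x : T) (y : S) :
  (A x -> B y) -> \1_A x <= \1_B y :> R.
Proof.
move=> AB; rewrite !indicE; have [Ax|Ax] := pselect (A x).
  by rewrite (mem_set Ax) (mem_set (AB Ax)).
by rewrite (memNset Ax).
Qed.

Lemma indic_le1 (T : Type) (A : set T) (x : T) : \1_A x <= 1 :> R.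
Proof. by rewrite indicE; case: (_ \in _). Qed.

Let half2 k : 2^-1 ^+ k * (2 ^ k)%:R = 1 :> R.
Proof. by rewrite natrX -exprMn mulVf// expr1n. Qed.

Lemma plateau_ge0 k x : 0 <= plateau k x.
Proof. by rewrite mulr_ge0 ?exprn_ge0//; apply: sumr_ge0. Qed.

Lemma plateau_le1 k x : plateau k x <= 1.
Proof.
rewrite -(half2 k) ler_wpM2l ?exprn_ge0//.
apply: (@le_trans _ _ (\sum_(0 <= i < 2 ^ k) (1 : R))).
  by apply: ler_sum => i _; exact: indic_le1.
by rewrite sumr_const_nat subn0.
Qed.

Lemma plateau_core k x : V 0 x -> plateau k x = 1.
Proof.
move=> V0x; rewrite /plateau.
rewrite (eq_bigr (fun=> 1)); first by rewrite sumr_const_nat subn0 half2.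
by move=> i _; rewrite indicE mem_set//; exact: (exhaustion_le VE (leq0n _)) V0x.
Qed.

Lemma plateau_out k x : ~ V (k + 2 ^ k)%N x -> plateau k x = 0.
Proof.
move=> nV; rewrite /plateau big_nat big1 ?mulr0// => i /andP[_ ik].
rewrite indicE memNset// => Vx; apply: nV; apply: (exhaustion_le VE) Vx.
by rewrite leq_add2l ltnW.
Qed.

Lemma sum_shift_le (a b : nat -> R) n : (forall i, a i <= b i.+1) ->
  (forall i, 0 <= b i <= 1) ->
  \sum_(0 <= i < n) a i <= \sum_(0 <= i < n) b i + 1.
Proof.
move=> ab b01; apply: le_trans (_ : \sum_(0 <= i < n) b i.+1 <= _).
  exact: ler_sum.
have := telescope_sumr b (leq0n n); rewrite sumrB.
by have := b01 0%N; have := b01 n; lra.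
Qed.

(** If g is in V k then x in V i implies g^-1 x in V (i + 1) for i >= k, and
    conversely. So the two sums of indicators are interlaced, and differ by at most
    one by telescoping ([sum_shift_le]). *)
Lemma plateau_slow k g x : V k g ->
  `|plateau k (translation g x) - plateau k x| <= 2^-1 ^+ k.
Proof.
move=> Vg; rewrite /plateau -mulrBr normrM ger0_norm ?exprn_ge0//.
rewrite -[leRHS]mulr1 ler_wpM2l ?exprn_ge0//.
have b01 y i : 0 <= (\1_(V (k + i)) y : R) <= 1 by rewrite indic_le1 andbT.
have Vgi i : V (k + i)%N g by apply: (exhaustion_le VE) Vg; exact: leq_addr.
have h1 : \sum_(0 <= i < 2 ^ k) \1_(V (k + i)) (translation g x) <=
    \sum_(0 <= i < 2 ^ k) \1_(V (k + i)) x + 1 :> R.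
  apply: sum_shift_le => // i; apply: indic_le => Vx.
  have -> : x = (g * translation g x)%g :> G by rewrite /translation mulgA mulgV mul1g.
  by rewrite addnS; exact: (exhaustionM VE).
have h2 : \sum_(0 <= i < 2 ^ k) \1_(V (k + i)) x <=
    \sum_(0 <= i < 2 ^ k) \1_(V (k + i)) (translation g x) + 1 :> R.
  apply: sum_shift_le => // i; apply: indic_le => Vx.
  by rewrite addnS; apply: (exhaustionM VE) => //; exact: exhaustionV.
by rewrite ler_norml; lra.
Qed.

Lemma plateau_translation_out k g x : V k g -> ~ V (k + 2 ^ k).+1 x ->
  plateau k (translation g x) - plateau k x = 0.
Proof.
move=> Vg nVx; rewrite !plateau_out ?subrr// => Vx; apply: nVx.
  exact: (exhaustion_le VE (leqnSn _)).
have -> : x = (g * translation g x)%g :> G by rewrite /translation mulgA mulgV mul1g.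
by apply: (exhaustionM VE) => //; apply: (exhaustion_le VE) Vg; exact: leq_addr.
Qed.

Lemma plateau_disjoint k g x : ~ V (k + 2 ^ k).+1 g -> V 0 x ->
  plateau k (translation g x) = 0.
Proof.
move=> nVg Vx; apply: plateau_out => Vgx; apply: nVg.
have -> : g = (x * (translation g x)^-1)%g :> G.
  by rewrite /translation invgM invgK mulgA mulgV mul1g.
apply: (exhaustionM VE); first exact: (exhaustion_le VE (leq0n _)).
exact: exhaustionV.
Qed.

Lemma measurable_plateau k : (forall n, measurable (V n : set (borelType G))) ->
  measurable_fun [set: borelType G] (plateau k).
Proof.
move=> mV; apply: measurable_funM => //.
by apply: measurable_sum => i; exact: measurable_indic.
Qed.

End plateau.

(** * Sums over a sparse set of indices *)

(** An index n < N in the range of m is of the form m k with k <= m k < N, so that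
    the double sum over n and k < N of the terms with m k = n lies in between. *)
Lemma sparse_sum_le (R : realType) (a : nat -> R) (m : nat -> nat) N :
  (forall n, 0 <= a n) -> (forall k, (k <= m k)%N) ->
  (forall n, (forall k, m k <> n) -> a n = 0) ->
  \sum_(0 <= n < N) a n <= \sum_(0 <= k < N) a (m k).
Proof.
move=> a0 mk an0.
apply: (@le_trans _ _ (\sum_(0 <= n < N) \sum_(0 <= k < N) (if m k == n then a n else 0))).
  rewrite [leLHS]big_nat [leRHS]big_nat; apply: ler_sum => n /andP[_ nN].
  have [[k kn]|nk] := pselect (exists k, m k = n); last first.
    rewrite an0; first by apply: sumr_ge0 => k _; case: ifP.
    by move=> k kn; apply: nk; exists k.
  have kN : (k < N)%N by apply: leq_ltn_trans nN; rewrite -kn.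
  rewrite big_mkord (bigD1 (Ordinal kN))//= kn eqxx lerDl.
  by apply: sumr_ge0 => i _; case: ifP.
rewrite exchange_big/=; apply: ler_sum => k _.
have [kN|Nk] := ltnP (m k) N.
  rewrite big_mkord (bigD1 (Ordinal kN))//= eqxx big1 ?addr0// => i ik.
  by rewrite ifN// eq_sym.
rewrite big_nat big1// => n /andP[_ nN]; rewrite ifN//.
by apply/eqP => kn; move: nN; rewrite -kn ltnNge Nk.
Qed.

(** The indices m 0 < ... < m (N - 1) are distinct and below m N. *)
Lemma sparse_sum_ge (R : realType) (a : nat -> R) (m : nat -> nat) N :
  (forall n, 0 <= a n) -> (forall k, (m k < m k.+1)%N) ->
  \sum_(0 <= k < N) a (m k) <= \sum_(0 <= n < m N) a n.
Proof.
move=> a0 mm; elim: N => [|N IH]; first by rewrite big_geq// sumr_ge0.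
rewrite big_nat_recr//=; apply: le_trans (lerD IH (lexx _)) _.
rewrite [leRHS](big_cat_nat (n:=(m N).+1))//= big_nat_recr//= lerDl.
exact: sumr_ge0.
Qed.
(** * The proper cocycle *)

Section proper_cocycle.
Context (R : realType) (G : topologicalGroupType)
  (mu : {measure set (borelType G) -> \bar R}).
Hypothesis G_hausdorff : hausdorff_space G.
Hypothesis mu_haar : left_haar mu.
Variable V : nat -> set G.
Hypothesis VE : doubling_exhaustion V.
Hypothesis V0_gt0 : (0 < mu (V 0))%E.
Local Notation "f ~~ g" := ((f : borelType G -> R) = g %[ae mu]) (at level 70).
Local Notation L n := (LspaceType mu (le1_even_exponent R n)).
Local Notation psi := (plateau R V).

Let mV n : measurable (V n : set (borelType G)).
Proof. by apply: compact_borel => //; exact: exhaustion_compact VE n. Qed.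

Let mpsi k : measurable_fun [set: borelType G] (psi k).
Proof. exact: measurable_plateau. Qed.

Let mpsi_tr k g : measurable_fun [set: borelType G] (fun x => psi k (translation g x)).
Proof.
apply: measurableT_comp; first exact: mpsi.
exact: (translation_measure_preserving mu_haar g).1.
Qed.

Let even_ge0 n (x : R) : 0 <= x ^+ (2 * n).
Proof. exact: even_expr_ge0. Qed.

(** The two bounds say that the p-th roots of the measures of V (k + 2^k + 1) and of
    V 0, for p the exponent of the component m k, are at most 2 and at least 1/2.
    They hold for all large m k since p-th roots tend to 1. *)
Lemma large_exponents : exists m : nat -> nat,
  (forall k, (m k < m k.+1)%N) /\
  forall k, (mu (V (k + 2 ^ k).+1) <= (2 ^+ (2 * (m k).+1))%:E)%E /\
    ((2^-1 ^+ (2 * (m k).+1))%:E <= mu (V 0))%E.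
Proof.
have fin n : mu (V n) \is a fin_num.
  by rewrite ge0_fin_numE// left_haar_compact//; exact: exhaustion_compact.
pose v n := fine (mu (V n)).
have vE n : mu (V n) = (v n)%:E by rewrite fineK.
have v0 : 0 < v 0%N by rewrite -lte_fin -vE.
have /choice[b bP] : forall x : R, exists n, x <= n%:R.
  move=> x; exists (Num.bound `|x|); apply: le_trans (ler_norm x) _.
  exact: ltW (archi_boundP (normr_ge0 x)).
have le2 x n : (b x <= n)%N -> x <= 2 ^+ (2 * n.+1).
  move=> bn; apply: le_trans (bP x) _; rewrite -natrX ler_nat.
  apply: leq_trans bn _; apply: ltnW; apply: leq_trans (ltn_expl n (ltnSn 1)) _.
  by rewrite leq_pexp2l// mulnS leqW// leqW// leq_pmull.
(* A sum, so that m k is at least each of the numbers required and increases with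
   k. *)
pose m k := (b (v 0%N)^-1 + \sum_(0 <= j < k.+1) (b (v (j + 2 ^ j).+1)).+1)%N.
exists m; split=> [k|k].
  by rewrite /m ltn_add2l [X in (_ < X)%N]big_nat_recr//= -[X in (X < _)%N]addn0 ltn_add2l.
split; rewrite vE lee_fin.
  apply: le2; rewrite /m big_nat_recr//= addnA.
  by apply: leq_trans (leq_addl _ _); exact: leqnSn.
rewrite exprVn -[leRHS]invrK lef_pV2 ?posrE ?invr_gt0 ?exprn_gt0//.
by apply: le2; rewrite /m leq_addr.
Qed.

Variable m : nat -> nat.
Hypothesis m_incr : forall k, (m k < m k.+1)%N.
Hypothesis m_large : forall k,
  (mu (V (k + 2 ^ k).+1) <= (2 ^+ (2 * (m k).+1))%:E)%E /\
    ((2^-1 ^+ (2 * (m k).+1))%:E <= mu (V 0))%E.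

Let m_homo k l : (k < l)%N -> (m k < m l)%N.
Proof. by apply: (homo_ltn ltn_trans). Qed.

Let m_inj k l : m k = m l -> k = l.
Proof.
by move=> kl; have [/m_homo|/m_homo|//] := ltngtP k l; rewrite kl ltnn.
Qed.

Let m_ge k : (k <= m k)%N.
Proof. by elim: k => // k IH; exact: leq_ltn_trans IH (m_incr k). Qed.

(** The components outside the range of m are set to 0; injectivity of m makes the
    choice in the others unambiguous. *)
Lemma plateau_components : exists phi : forall n, L n,
  (forall k, Lspace_repr (phi (m k)) ~~ psi k) /\
  (forall n, (forall k, m k <> n) -> phi n = 0).
Proof.
have /choice_dep[phi phiP] : forall n, exists f : L n,
    (forall k, m k = n -> Lspace_repr f ~~ psi k) /\
    ((forall k, m k <> n) -> f = 0).
  move=> n; have [[k kn]|nk] := pselect (exists k, m k = n); last first.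
    by exists 0; split=> // k kn; exfalso; apply: nk; exists k.
  have [|f fE] := @Lspace_mk _ _ _ mu n _ (mpsi k).
    apply: (@le_lt_trans _ _ (\int[mu]_x (\1_(V (k + 2 ^ k)%N) x)%:E)%E).
      apply: ge0_le_integral => //.
      - by move=> x _; rewrite lee_fin.
      - by apply/measurable_EFinP; exact: measurable_funX.
      - by apply/measurable_EFinP; exact: measurable_indic.
      - move=> x _; rewrite lee_fin indicE; have [Vx|Vx] := pselect (V (k + 2 ^ k)%N x).
          by rewrite mem_set// expr_le1 ?plateau_ge0 ?plateau_le1.
        by rewrite memNset// plateau_out// expr0n.
    rewrite integral_indic// setIT left_haar_compact//.
    exact: exhaustion_compact.
  exists f; split=> [l ln|/(_ k)//].
  by have -> : l = k by apply: m_inj; rewrite kn.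
by exists phi; split=> [k|n]; [apply: (phiP _).1|apply: (phiP _).2].
Qed.

Variable phi : forall n, L n.
Hypothesis phiE : forall k, Lspace_repr (phi (m k)) ~~ psi k.
Hypothesis phi0 : forall n, (forall k, m k <> n) -> phi n = 0.

Let tr g n (f : L n) : L n := Lspace_comp (translation g) f.
Let mp g := translation_measure_preserving mu_haar g.

Let cob g n : L n := tr g (phi n) - phi n.

Let cob_norm g k : ((`|cob g (m k)| ^+ (2 * (m k).+1))%:E =
  \int[mu]_x ((psi k (translation g x) - psi k x) ^+ (2 * (m k).+1))%:E)%E.
Proof.
apply: Lspace_norm_ae; first exact: measurable_funB.
apply: (filterS3 _ _ (Lspace_reprB (tr g (phi (m k))) (phi (m k)))
  (Lspace_comp_ae (mp g) (phiE k)) (phiE k)) => x h1 h2 h3 _.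
by rewrite h1// h2// h3.
Qed.

(** The difference is at most 2^-k everywhere and vanishes off V (k + 2^k + 1), the
    p-th root of whose measure is at most 2. *)
Lemma coboundary_small g k : V k g -> `|cob g (m k)| <= 2 * 2^-1 ^+ k.
Proof.
move=> Vg; rewrite -Lspace_norm_le ?mulr_ge0 ?exprn_ge0// -lee_fin cob_norm.
set K := (2 * (m k).+1)%N; set U := V (k + 2 ^ k).+1.
apply: (@le_trans _ _ (\int[mu]_x (((2^-1 ^+ k) ^+ K)%:E * (\1_U x)%:E))%E).
  apply: ge0_le_integral => //.
  - by move=> x _; rewrite lee_fin even_ge0.
  - by apply/measurable_EFinP; apply: measurable_funX; exact: measurable_funB.
  - apply: measurable_funeM; apply/measurable_EFinP; apply: measurable_indic; exact: mV.
  - move=> x _; rewrite -EFinM lee_fin indicE; have [Ux|Ux] := pselect (U x).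
      rewrite mem_set// mulr1 -[leLHS]ger0_norm ?even_ge0// normrX.
      by rewrite lerXn2r ?nnegrE ?exprn_ge0// plateau_slow.
    by rewrite memNset// plateau_translation_out// mulr0 expr0n.
rewrite ge0_integralZl//; last first.
  by apply/measurable_EFinP; apply: measurable_indic; exact: mV.
rewrite integral_indic//; last exact: mV.
rewrite setIT exprMn mulrC EFinM lee_wpmul2l//; last exact: (m_large k).1.
Qed.

(** On V 0 the function psi k equals 1 and its translate vanishes. *)
Lemma coboundary_large g k : ~ V (k + 2 ^ k).+1 g -> 2^-1 <= `|cob g (m k)|.
Proof.
move=> nVg; rewrite -(ler_pXn2r (n:=2 * (m k).+1))// ?nnegrE//.
rewrite -lee_fin cob_norm; apply: le_trans (m_large k).2 _.
rewrite -[V 0]setIT -(integral_indic mu measurableT (mV 0)).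
apply: ge0_le_integral => //.
- by apply/measurable_EFinP; apply: measurable_indic; exact: mV.
- by apply/measurable_EFinP; apply: measurable_funX; exact: measurable_funB.
- move=> x _; rewrite lee_fin indicE; have [Vx|Vx] := pselect (V 0 x).
    by rewrite mem_set// plateau_disjoint// plateau_core// sub0r exprM sqrrN !expr1n.
  by rewrite memNset// even_ge0.
Qed.

(** g belongs to V k for all k >= k0, so all but finitely many components are
    bounded by a geometric sequence. *)
Lemma coboundary_summable g : exists c, forall N,
  \sum_(0 <= n < N) `|cob g n| ^+ 2 <= c.
Proof.
have [k0 Vg] := exhaustion_full VE g.
pose a n := `|cob g n| ^+ 2.
have a0 n : 0 <= a n by exact: sqr_ge0.
have tr0 n : tr g (0 : L n) = 0.
  by apply/eqP; rewrite -normr_eq0 Lspace_comp_norm ?normr0.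
have an0 n : (forall k, m k <> n) -> a n = 0.
  by move=> /phi0 phin; rewrite /a /cob phin subr0 tr0 normr0 expr0n.
exists (\sum_(0 <= k < k0) a (m k) + 8) => N.
apply: le_trans (sparse_sum_le N a0 m_ge an0) _.
have geom n : \sum_(0 <= k < n) (2 * 2^-1 ^+ k) ^+ 2 <= 8 - 8 * 2^-1 ^+ n :> R.
  elim: n => [|n IH]; first by rewrite big_geq// expr0 mulr1 subrr.
  rewrite big_nat_recr//= [in leRHS]exprS.
  have q0 : 0 <= (2^-1 : R) ^+ n by rewrite exprn_ge0.
  have q1 : (2^-1 : R) ^+ n <= 1 by rewrite exprn_ile1// invf_le1// ler1n.
  have : (2 * 2^-1 ^+ n) ^+ 2 <= 4 * 2^-1 ^+ n :> R.
    by rewrite exprMn -natrX ler_wpM2l// expr2 ler_piMl.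
  by move: IH; lra.
have geom8 n : \sum_(0 <= k < n) (2 * 2^-1 ^+ k) ^+ 2 <= 8 :> R.
  by apply: le_trans (geom n) _; rewrite gerBl mulr_ge0// exprn_ge0.
have tail k : (k0 <= k)%N -> a (m k) <= (2 * 2^-1 ^+ k) ^+ 2.
  move=> kk; rewrite lerXn2r ?nnegrE ?mulr_ge0 ?exprn_ge0//.
  by apply: coboundary_small; exact: (exhaustion_le VE kk) Vg.
have split_sum : \sum_(0 <= k < N) a (m k) <=
    \sum_(0 <= k < N) ((if (k < k0)%N then a (m k) else 0) + (2 * 2^-1 ^+ k) ^+ 2).
  apply: ler_sum => k _; case: ltnP => [_|/tail]; last by rewrite add0r.
  by rewrite lerDl sqr_ge0.
apply: le_trans split_sum _; rewrite big_split/= lerD//.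
apply: le_trans (_ : \sum_(0 <= k < N + k0) (if (k < k0)%N then a (m k) else 0) <= _).
  rewrite [leRHS](big_cat_nat (n:=N))//= ?leq_addr// lerDl.
  by apply: sumr_ge0 => k _; case: ifP.
rewrite (big_cat_nat (n:=k0))//= ?leq_addl//.
rewrite [X in _ + X <= _]big_nat [X in _ + X <= _]big1 ?addr0; last first.
  by move=> k /andP[k0k _]; rewrite ltnNge k0k.
by rewrite big_nat [leRHS]big_nat; apply: ler_sum => k /andP[_ ->].
Qed.

Lemma proper_isometric_action : exists alpha : affine_action G (L2n_sum mu),
  isometric_action alpha /\ proper_action alpha.
Proof.
pose S g n (f : L n) : L n := tr g f.
have S_norm g n (f : L n) : `|S g n f| = `|f| by exact: Lspace_comp_norm.
have S_lin g n a (f h : L n) : S g n (a *: f + h) = a *: S g n f + S g n h.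
  exact: Lspace_compP.
pose pi g : {linear L2n_sum mu -> L2n_sum mu} :=
  HB.pack (l2sum_map (S_norm g) : L2n_sum mu -> L2n_sum mu)
    (GRing.isLinear.Build R (L2n_sum mu) (L2n_sum mu) *:%R
      (l2sum_map (S_norm g)) (l2sum_map_linear (S_norm g) (S_lin g))).
have piE g xi n : pi g xi n = tr g (xi n) by exact: l2sum_mapE.
have /choice[b bE] : forall g, exists b : L2n_sum mu, forall n, b n = cob g n.
  move=> g; have [c cP] := coboundary_summable g.
  by have [b bE _] := l2sum_mk cP; exists b.
have trM g h n (f : L n) : tr (g * h)%g f = tr g (tr h f).
  rewrite /tr Lspace_comp_comp//; congr Lspace_comp.
  by apply/funext => x; rewrite /translation/= invgM mulgA.
have [||||alpha [iso prop]] := @isometric_action_of_cocycle R G (L2n_sum mu) pi b.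
- by move=> g x; exact: l2sum_map_norm.
- move=> x; apply: l2sum_ext => n; rewrite piE /tr.
  rewrite (_ : translation 1%g = id) ?Lspace_comp_id//.
  by apply/funext => y; rewrite /translation invg1 mul1g.
- by move=> g h x; apply: l2sum_ext => n; rewrite !piE trM.
- move=> g h; apply: l2sum_ext => n; rewrite bE /cob trM.
  rewrite -[RHS]/(pi g (b h) n + b g n) piE !bE /cob.
  have -> : tr h (phi n) - phi n = (-1) *: phi n + tr h (phi n).
    by rewrite scaleN1r addrC.
  by rewrite [in RHS]/tr Lspace_compP// scaleN1r addrACA addNr add0r.
exists alpha; split => //; apply: prop => C.
(* Off V (J + 2 ^ J + 1) the components m 0, ..., m (J - 1) have norm at least 1/2,
   so the square of the norm is at least J / 4. *)
have [J JC] : exists J : nat, C ^+ 2 * 4 <= J%:R.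
  exists (Num.bound (C ^+ 2 * 4)); apply: ltW; apply: archi_boundP.
  by rewrite mulr_ge0// sqr_ge0.
exists (V (J + 2 ^ J).+1); first exact: exhaustion_compact.
move=> g nVg; apply: le_trans (ler_norm C) _.
rewrite -(ler_pXn2r (n:=2))// ?nnegrE// real_normK ?num_real//.
apply: le_trans (l2sum_partial_le (b g) (m J)).
apply: le_trans (sparse_sum_ge J (fun n => sqr_ge0 `|b g n|) m_incr).
apply: (@le_trans _ _ (\sum_(0 <= k < J) (4^-1 : R))).
  by rewrite sumr_const_nat subn0 -mulr_natr; lra.
rewrite big_nat [leRHS]big_nat; apply: ler_sum => k /andP[_ kJ].
have -> : 4^-1 = 2^-1 ^+ 2 :> R by rewrite exprVn -natrX.
rewrite lerXn2r ?nnegrE ?invr_ge0// bE; apply: coboundary_large => Vg; apply: nVg.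
apply: (exhaustion_le VE) Vg; rewrite ltnS leq_add ?(ltnW kJ)//.
by rewrite leq_pexp2l// ltnW.
Qed.

End proper_cocycle.
(** * Conclusion *)

(** A countable union of null sets is null. *)
Lemma sigma_compact_positive (R : realType) (G : topologicalGroupType)
    (mu : {measure set (borelType G) -> \bar R}) (C : nat -> set G) :
  mu [set: G] != 0%E -> (forall n, measurable (C n : set (borelType G))) ->
  (forall x, exists n, C n x) -> exists n, (0 < mu (C n))%E.
Proof.
move=> mu0 mC CT; apply: contrapT => /forallNP C0.
have : mu.-negligible (\bigcup_n (C n : set (borelType G))).
  apply: negligible_bigcup => n; exists (C n); split=> //.
  by apply/eqP; rewrite eq_le measure_ge0 andbT leNgt; exact/negP/C0.
rewrite (_ : \bigcup_n _ = [set: borelType G]).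
  by move=> /(measure_negligible measurableT)/eqP; rewrite (negbTE mu0).
by apply/seteqP; split=> // x _; have [n Cn] := CT x; exists n.
Qed.

Theorem theorem6p5 (R : realType) (G : topologicalGroupType)
  (G_hausdorff : hausdorff_space G)
  (G_locally_compact : locally_compact [set: G])
  (G_second_countable : @second_countable G)
  (mu : {measure set (borelType G) -> \bar R}) (mu_haar : left_haar mu) :
  [/\ banach_space (L2n_sum mu),
      separable (L2n_sum mu),
      strictly_convex (L2n_sum mu) &
      reflexive_space (L2n_sum mu)] /\
  exists alpha : affine_action G (L2n_sum mu),
    isometric_action alpha /\ proper_action alpha.
Proof.
split.
  split.
  - by apply: l2sum_banach => n; exact: Lspace_banach.
  - have [B cB [mB appB]] := left_haar_countable_approx mu_haar G_second_countable.
    have [S cS Stot] : countably_total (L2n_sum mu).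
      by apply: l2sum_countably_total => n; exact: (Lspace_countably_total _ cB mB appB).
    exact: separable_total cS Stot.
  - by apply: l2sum_strictly_convex => n; exact: Lspace_strictly_convex.
  - apply: norm_reflexive_reflexive; apply: l2sum_norm_reflexive => n.
    exact: milman_pettis (@Lspace_banach _ _ _ mu n) (@Lspace_uniformly_convex _ _ _ mu n).
have [C cC CT] := sigma_compact G_locally_compact G_second_countable.
have [j Cj] := sigma_compact_positive (left_haar_neq0 mu_haar)
  (fun n => compact_borel G_hausdorff (cC n)) CT.
have VE := exhaustionP (cC j) cC CT.
have V0 : (0 < mu (exhaustion (C j) C 0))%E.
  apply: lt_le_trans Cj _; apply: le_measure; rewrite ?inE.
  - exact: compact_borel.
  - by apply: compact_borel => //; exact: exhaustion_compact VE 0%N.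
  - by move=> x Cx; left; left.
have [m [m_incr m_large]] := large_exponents mu_haar VE V0.
have [phi [phiE phi0]] := plateau_components G_hausdorff mu_haar VE m_incr.
exact: (proper_isometric_action G_hausdorff mu_haar VE m_incr m_large phiE phi0).
Qed.
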